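(* Let $(W,S)$ be a Coxeter system such that $S$ admits a well-ordering. Then every locally finite subgroup of $W$ is contained in a maximal locally finite subgroup of $W$, and every such maximal locally finite subgroup containing it is locally parabolic.
   Context: A group is locally finite if each finite subset generates a finite subgroup; a maximal locally finite subgroup is a locally finite subgroup not properly contained in another locally finite subgroup of $W$. For a reflection subgroup $G$ (subgroup generated by reflections), $S(G)=\{s_\gamma\mid\gamma\in\Pi(G)\}$ is its canonical generating set, where $\Pi(G)$ is the set of positive roots $\gamma$ (geometric representation) with $s_\gamma\in G$ not expressible as positive linear combinations of other positive roots $\beta$ with $s_\beta\in G$. $G\le W$ is locally parabolic if it is a reflection subgroup and each finite subset of $S(G)$ is conjugate in $W$ to a subset of $S$. *)

(* Defs.v *)
From Stdlib Require Import Reals List ClassicalEpsilon.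
Import ListNotations.


Record Group := {
  gcar :> Type;
  gmul : gcar -> gcar -> gcar;
  gone : gcar;
  ginv : gcar -> gcar;
  gmulA : forall x y z, gmul x (gmul y z) = gmul (gmul x y) z;
  gmul1 : forall x, gmul gone x = x;
  gmulV : forall x, gmul (ginv x) x = gone
}.

Fixpoint gpow (G : Group) (x : G) (n : nat) : G :=
  match n with
  | O => gone G
  | Datatypes.S k => gmul G x (gpow G x k)
  end.

Definition elt_order (G : Group) (x : G) (m : nat) : Prop :=
  (0 < m)%nat /\ gpow G x m = gone G /\
  (forall k, (0 < k < m)%nat -> gpow G x k <> gone G).

Definition is_hom (G H : Group) (f : G -> H) : Prop :=
  forall x y, f (gmul G x y) = gmul H (f x) (f y).

Definition subgroup (G : Group) (H : G -> Prop) : Prop :=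
  H (gone G) /\ (forall x y, H x -> H y -> H (gmul G x y)) /\
  (forall x, H x -> H (ginv G x)).

Definition gen (G : Group) (A : G -> Prop) (x : G) : Prop :=
  forall K, subgroup G K -> (forall y, A y -> K y) -> K x.

(** (W,S) is a Coxeter system: S consists of involutions, generates W, and
    W has the presentation < S | (st)^{m(s,t)} = 1 > (universal property),
    where m(s,t) is the order of st in W (relations only for finite m). *)
Definition coxeter_system (W : Group) (S : W -> Prop) : Prop :=
  (forall s, S s -> s <> gone W /\ gmul W s s = gone W) /\
  (forall x, gen W S x) /\
  (forall (H : Group) (f : W -> H),
     (forall s t m, S s -> S t -> elt_order W (gmul W s t) m ->
        gpow H (gmul H (f s) (f t)) m = gone H) ->
     exists phi : W -> H, is_hom W H phi /\ forall s, S s -> phi s = f s).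

Definition well_orderable (W : Group) (S : W -> Prop) : Prop :=
  exists le : W -> W -> Prop,
    (forall x, S x -> le x x) /\
    (forall x y, S x -> S y -> le x y -> le y x -> x = y) /\
    (forall x y z, S x -> S y -> S z -> le x y -> le y z -> le x z) /\
    (forall x y, S x -> S y -> le x y \/ le y x) /\
    (forall P : W -> Prop, (forall x, P x -> S x) -> (exists x, P x) ->
       exists m, P m /\ forall x, P x -> le m x).

Definition locally_finite (W : Group) (H : W -> Prop) : Prop :=
  subgroup W H /\
  forall L : list W, (forall x, In x L -> H x) ->
    exists l : list W, forall x, gen W (fun y => In y L) x -> In x l.

Definition maximal_locally_finite (W : Group) (H : W -> Prop) : Prop :=
  locally_finite W H /\
  forall K, locally_finite W K -> (forall x, H x -> K x) -> forall x, K x -> H x.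

Definition is_reflection (W : Group) (S : W -> Prop) (t : W) : Prop :=
  exists w s, S s /\ t = gmul W (gmul W w s) (ginv W w).

Definition reflection_subgroup (W : Group) (S : W -> Prop) (H : W -> Prop) : Prop :=
  exists A : W -> Prop, (forall t, A t -> is_reflection W S t) /\
    forall x, H x <-> gen W A x.

(** Geometric representation.  V has basis (alpha_s)_{s in S}; a vector is
    its coefficient function W -> R (supported on S).
    B(alpha_s, alpha_t) = - cos (pi / m(s,t)), and -1 if m(s,t) = infinity. *)
Definition Bst (W : Group) (s t : W) : R :=
  match excluded_middle_informative (exists m, elt_order W (gmul W s t) m) with
  | left H => - cos (PI / INR (proj1_sig (constructive_indefinite_description _ H)))
  | right _ => -1
  end.

(** Formal linear combinations sum_i c_i alpha_{s_i} and their coefficient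
    functions. *)
Definition fsum (W : Group) (l : list (R * W)) (x : W) : R :=
  fold_right (fun p acc =>
    (if excluded_middle_informative (snd p = x) then fst p else 0) + acc)%R 0%R l.

(** sigma_s(v) = v - 2 B(alpha_s, v) alpha_s, on formal combinations. *)
Definition refl_combo (W : Group) (s : W) (l : list (R * W)) : list (R * W) :=
  ((- (2 * fold_right (fun p acc => fst p * Bst W s (snd p) + acc) 0 l))%R, s) :: l.

Definition word_prod (W : Group) (ws : list W) : W :=
  fold_right (gmul W) (gone W) ws.

(** [gamma] is a root, namely gamma = w(alpha_s) with w = s_1...s_k, and
    s_gamma = t = w s w^{-1}. *)
Definition root_refl (W : Group) (S : W -> Prop) (gamma : W -> R) (t : W) : Prop :=
  exists (ws : list W) (s : W),
    (forall u, In u ws -> S u) /\ S s /\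
    (forall x, gamma x = fsum W (fold_right (refl_combo W) [(1%R, s)] ws) x) /\
    t = gmul W (gmul W (word_prod W ws) s) (ginv W (word_prod W ws)).

Definition positive_root (W : Group) (S : W -> Prop) (gamma : W -> R) : Prop :=
  (exists t, root_refl W S gamma t) /\ forall x, (0 <= gamma x)%R.

Definition Phi_plus_of (W : Group) (S : W -> Prop) (G : W -> Prop) (gamma : W -> R) : Prop :=
  positive_root W S gamma /\ exists t, root_refl W S gamma t /\ G t.

Definition Pi_of (W : Group) (S : W -> Prop) (G : W -> Prop) (gamma : W -> R) : Prop :=
  Phi_plus_of W S G gamma /\
  ~ exists l : list (R * (W -> R)),
      (forall p, In p l -> (0 < fst p)%R /\ Phi_plus_of W S G (snd p) /\
                           ~ (forall x, snd p x = gamma x)) /\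
      forall x, gamma x = fold_right (fun p acc => fst p * snd p x + acc)%R 0%R l.

Definition canonical_gens (W : Group) (S : W -> Prop) (G : W -> Prop) (t : W) : Prop :=
  exists gamma, Pi_of W S G gamma /\ root_refl W S gamma t.

Definition locally_parabolic (W : Group) (S : W -> Prop) (G : W -> Prop) : Prop :=
  reflection_subgroup W S G /\
  forall L : list W, (forall x, In x L -> canonical_gens W S G x) ->
    exists w : W, forall x, In x L -> S (gmul W (gmul W w x) (ginv W w)).

(* Main.v *)
(* Let [W] act on the linear forms [f : W -> R] dual to the geometric
   representation. The basic fact is that the root [w(alpha_s)] is nonnegative
   when [len w <= len (w s)], and nonpositive otherwise. Hence the elements of
   [W_J] fixing a form [f] that is nonnegative on [J] are generated by those
   [s] in [J] with [f s = 0]. It follows that parabolic subgroups are closed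
   under intersection, and that a finite subgroup [F] lies in a finite
   parabolic subgroup: make the [F]-invariant form [sum_(h in F) h.1] dominant
   and take its stabiliser. So every finite subset [L] of a locally finite [M]
   has a finite parabolic hull; the union of these hulls is locally finite and
   contains [M], so it equals [M] when [M] is maximal. Then any finite set of
   canonical generators of [M] lies in some parabolic [w W_J w^-1] inside [M]
   with [w] of minimal length in [w W_J], and indecomposability of a canonical
   root [gamma = sum_t c_t w(alpha_t)], [t] in [J], forces [gamma] to be some
   [w(alpha_t)]. Maximal subgroups exist by Zorn's lemma. *)

From mathcomp Require classical_sets.
Require Import Defs.
From Stdlib Require Import Reals List Lra Lia Arith Permutation.
From Stdlib Require Import ClassicalEpsilon FunctionalExtensionality.
From Stdlib Require Import PropExtensionality ProofIrrelevance.
Import ListNotations.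
Set Implicit Arguments.
Unset Strict Implicit.
Set Bullet Behavior "Strict Subproofs".

(** * Extremal choices and finite real sums *)

Lemma nat_least (P : nat -> Prop) :
  (exists n, P n) -> exists n, P n /\ forall k, P k -> (n <= k)%nat.
Proof.
  intros [n Hn]. revert Hn. induction n as [n IH] using lt_wf_ind. intro Hn.
  destruct (classic (exists k, (k < n)%nat /\ P k)) as [[k [Hk Pk]]|H].
  - exact (IH k Hk Pk).
  - exists n. split; [exact Hn|]. intros k Pk.
    destruct (le_lt_dec n k) as [|Hlt]; [assumption|].
    exfalso. apply H. now exists k.
Qed.

Lemma exists_minimizer (T : Type) (P : T -> Prop) (f : T -> nat) :
  (exists x, P x) -> exists x, P x /\ forall y, P y -> (f x <= f y)%nat.
Proof.
  intros [x0 H0].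
  destruct (@nat_least (fun n => exists x, P x /\ f x = n)) as [n [[x [Px <-]] Hmin]].
  { now exists (f x0), x0. }
  exists x. split; [exact Px|]. intros y Py. apply Hmin. now exists y.
Qed.

Lemma exists_maximizer (T : Type) (P : T -> Prop) (f : T -> nat) (N : nat) :
  (exists x, P x) -> (forall x, P x -> (f x <= N)%nat) ->
  exists x, P x /\ forall y, P y -> (f y <= f x)%nat.
Proof.
  intros Hex Hbd.
  destruct (@exists_minimizer T P (fun x => (N - f x)%nat) Hex) as [x [Px Hmin]].
  exists x. split; [exact Px|]. intros y Py.
  specialize (Hmin y Py). pose proof (Hbd x Px). pose proof (Hbd y Py). lia.
Qed.

Definition decide (Q : Prop) : bool := if excluded_middle_informative Q then true else false.

Lemma decide_true (Q : Prop) : decide Q = true <-> Q.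
Proof. unfold decide. destruct excluded_middle_informative; split; (tauto || discriminate). Qed.

Lemma decide_false (Q : Prop) : decide Q = false <-> ~ Q.
Proof. unfold decide. destruct excluded_middle_informative; split; (tauto || discriminate). Qed.

Lemma list_NoDup (T : Type) (l : list T) : exists D, NoDup D /\ forall x, In x D <-> In x l.
Proof.
  exists (nodup (fun x y => excluded_middle_informative (x = y)) l).
  split; [apply NoDup_nodup|apply nodup_In].
Qed.

Definition lsum (T : Type) (D : list T) (g : T -> R) : R :=
  fold_right (fun x acc => g x + acc)%R 0%R D.

Lemma lsum_ext (T : Type) (D : list T) (g h : T -> R) :
  (forall x, In x D -> g x = h x) -> lsum D g = lsum D h.
Proof.
  induction D as [|a D IH]; intro H; [reflexivity|]. simpl.
  rewrite (H a) by now left. f_equal. apply IH. intros x Hx. apply H. now right.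
Qed.

Lemma lsum_add (T : Type) (D : list T) (g h : T -> R) :
  lsum D (fun x => g x + h x)%R = (lsum D g + lsum D h)%R.
Proof. induction D as [|a D IH]; simpl; [ring|]. rewrite IH. ring. Qed.

Lemma lsum_zero (T : Type) (D : list T) (g : T -> R) :
  (forall x, In x D -> g x = 0%R) -> lsum D g = 0%R.
Proof.
  induction D as [|a D IH]; intro H; [reflexivity|]. simpl.
  rewrite (H a) by now left. rewrite IH; [ring|]. intros x Hx. apply H. now right.
Qed.

Lemma lsum_nonneg (T : Type) (D : list T) (g : T -> R) :
  (forall x, In x D -> 0 <= g x)%R -> (0 <= lsum D g)%R.
Proof.
  induction D as [|a D IH]; intro H; simpl; [lra|].
  apply Rplus_le_le_0_compat; [apply H; now left|]. apply IH. intros x Hx. apply H. now right.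
Qed.

Lemma lsum_nonneg_eq0 (T : Type) (D : list T) (g : T -> R) :
  (forall x, In x D -> 0 <= g x)%R -> lsum D g = 0%R -> forall x, In x D -> g x = 0%R.
Proof.
  induction D as [|a D IH]; intros H E x [].
  - subst a. simpl in E.
    assert (0 <= lsum D g)%R by (apply lsum_nonneg; intros; apply H; now right).
    assert (0 <= g x)%R by (apply H; now left). lra.
  - simpl in E. apply IH; [intros; apply H; now right| |assumption].
    assert (0 <= lsum D g)%R by (apply lsum_nonneg; intros; apply H; now right).
    assert (0 <= g a)%R by (apply H; now left). lra.
Qed.

Lemma lsum_filter (T : Type) (p : T -> bool) (D : list T) (g : T -> R) :
  (forall x, In x D -> p x = false -> g x = 0%R) -> lsum (filter p D) g = lsum D g.
Proof.
  induction D as [|a D IH]; intro H; [reflexivity|].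
  simpl. rewrite <- IH by (intros x Hx; apply H; now right).
  destruct (p a) eqn:E; [reflexivity|]. rewrite (H a) by (auto; now left). ring.
Qed.

(** * Elementary group theory *)

Section Groups.
Context (G : Group).
Local Notation "x ** y" := (gmul G x y) (at level 40, left associativity).
Local Notation inv := (ginv G).
Local Notation e := (gone G).

Lemma gmulVr (x : G) : x ** inv x = e.
Proof.
  rewrite <- (gmul1 G (x ** inv x)), <- (gmulV G (inv x)) at 1.
  rewrite <- gmulA, (gmulA G (inv x) x), gmulV, gmul1. apply gmulV.
Qed.

Lemma gmulr1 (x : G) : x ** e = x.
Proof. now rewrite <- (gmulV G x), gmulA, gmulVr, gmul1. Qed.

Lemma gmulVK (x y : G) : inv x ** (x ** y) = y.
Proof. now rewrite gmulA, gmulV, gmul1. Qed.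

Lemma gmulKV (x y : G) : x ** (inv x ** y) = y.
Proof. now rewrite gmulA, gmulVr, gmul1. Qed.

Lemma ginv_unique (x y : G) : x ** y = e -> inv x = y.
Proof. intro H. now rewrite <- (gmulr1 (inv x)), <- H, gmulVK. Qed.

Lemma ginvM (x y : G) : inv (x ** y) = inv y ** inv x.
Proof.
  apply ginv_unique.
  now rewrite <- gmulA, gmulKV, gmulVr.
Qed.

Lemma ginvK (x : G) : inv (inv x) = x.
Proof. apply ginv_unique, gmulV. Qed.

Lemma ginv1 : inv e = e.
Proof. apply ginv_unique, gmul1. Qed.

Lemma gpow_add (x : G) (m n : nat) : gpow G x (m + n) = gpow G x m ** gpow G x n.
Proof.
  induction m as [|m IH]; simpl; [now rewrite gmul1|].
  now rewrite IH, gmulA.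
Qed.

Lemma elt_order_unique (x : G) (m n : nat) :
  elt_order G x m -> elt_order G x n -> m = n.
Proof.
  intros [Hm [Em Mm]] [Hn [En Mn]].
  destruct (lt_eq_lt_dec m n) as [[H|H]|H]; [|exact H|].
  - exfalso. exact (Mn m (conj Hm H) Em).
  - exfalso. exact (Mm n (conj Hn H) En).
Qed.

Lemma gpow_inv (x : G) (n : nat) : gpow G (inv x) n = inv (gpow G x n).
Proof.
  induction n as [|n IH]; simpl; [now rewrite ginv1|].
  rewrite ginvM, <- IH. clear IH.
  induction n as [|n IH]; simpl; [now rewrite gmulr1, gmul1|].
  now rewrite <- gmulA, <- IH.
Qed.

Lemma elt_order_inv (x : G) (m : nat) : elt_order G x m -> elt_order G (inv x) m.
Proof.
  assert (H1 : forall y : G, inv y = e -> y = e).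
  { intros y Hy. now rewrite <- (ginvK y), Hy, ginv1. }
  intros [Hm [Em Mm]]. repeat split; [exact Hm| |].
  - now rewrite gpow_inv, Em, ginv1.
  - intros k Hk E. rewrite gpow_inv in E. exact (Mm k Hk (H1 _ E)).
Qed.

Lemma gen_mono (A B : G -> Prop) (x : G) :
  (forall y, A y -> gen G B y) -> gen G A x -> gen G B x.
Proof.
  intros HAB Hx K HK HB. apply Hx; [exact HK|].
  intros y Hy. exact (HAB y Hy K HK HB).
Qed.

Lemma gen_subgroup (A : G -> Prop) : subgroup G (gen G A).
Proof.
  repeat split.
  - intros K [H1 _] _. exact H1.
  - intros x y Hx Hy K HK HA. destruct HK as [K1 [KM KV]].
    apply KM; [apply Hx|apply Hy]; repeat split; assumption.
  - intros x Hx K HK HA. destruct HK as [K1 [KM KV]].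
    apply KV, Hx; repeat split; assumption.
Qed.

Lemma gen_incl (A : G -> Prop) (x : G) : A x -> gen G A x.
Proof. intros Hx K _ HA. now apply HA. Qed.

Lemma gen_mul (A : G -> Prop) (x y : G) :
  gen G A x -> gen G A y -> gen G A (x ** y).
Proof. apply gen_subgroup. Qed.

Lemma gen_inv (A : G -> Prop) (x : G) : gen G A x -> gen G A (inv x).
Proof. apply gen_subgroup. Qed.

Lemma gen_one (A : G -> Prop) : gen G A e.
Proof. apply gen_subgroup. Qed.

Lemma subgroup_conj (H : G -> Prop) (a : G) :
  subgroup G H -> subgroup G (fun x => H (inv a ** x ** a)).
Proof.
  intros [H1 [HM HV]]. repeat split.
  - now rewrite gmulr1, gmulV.
  - intros x y Hx Hy.
    replace (inv a ** (x ** y) ** a) with ((inv a ** x ** a) ** (inv a ** y ** a)); [now apply HM|].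
    now rewrite <- !gmulA, gmulKV.
  - intros x Hx.
    replace (inv a ** inv x ** a) with (inv (inv a ** x ** a)); [now apply HV|].
    now rewrite !ginvM, ginvK, <- !gmulA.
Qed.

Lemma word_prod_app (l l' : list G) :
  word_prod G (l ++ l') = word_prod G l ** word_prod G l'.
Proof.
  induction l as [|a l IH]; simpl; [now rewrite gmul1|].
  now rewrite IH, gmulA.
Qed.

End Groups.

Ltac gsimp := repeat first
  [ rewrite ginvM | rewrite ginvK | rewrite ginv1 | rewrite <- gmulA
  | rewrite gmulVK | rewrite gmulKV | rewrite gmulV | rewrite gmulVr
  | rewrite gmul1 | rewrite gmulr1 ].

Ltac group := gsimp; reflexivity.

(** * Permutation groups, as targets for the universal property *)

Record perm (T : Type) := {
  pfun :> T -> T;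
  pinv : T -> T;
  pfunK : forall x, pfun (pinv x) = x;
  pinvK : forall x, pinv (pfun x) = x
}.

Lemma perm_ext (T : Type) (p q : perm T) : (forall x, p x = q x) -> p = q.
Proof.
  intro H.
  assert (Hi : pinv p = pinv q).
  { extensionality x. now rewrite <- (pinvK p (pinv q x)), H, pfunK. }
  destruct p as [f g A B], q as [f' g' A' B']; simpl in *. subst g'.
  assert (f = f') by now extensionality x. subst f'.
  f_equal; apply proof_irrelevance.
Qed.

Definition perm_one (T : Type) : perm T :=
  {| pfun := fun x => x; pinv := fun x => x;
     pfunK := fun _ => eq_refl; pinvK := fun _ => eq_refl |}.

Definition perm_mul (T : Type) (p q : perm T) : perm T.
Proof.
  refine {| pfun := fun x => p (q x); pinv := fun x => pinv q (pinv p x) |}.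
  - intro x. now rewrite !pfunK.
  - intro x. now rewrite !pinvK.
Defined.

Definition perm_inv (T : Type) (p : perm T) : perm T :=
  {| pfun := pinv p; pinv := p; pfunK := pinvK p; pinvK := pfunK p |}.

Definition perm_group (T : Type) : Group.
Proof.
  refine {| gcar := perm T; gmul := @perm_mul T; gone := perm_one T; ginv := @perm_inv T |}.
  - intros; now apply perm_ext.
  - intros; now apply perm_ext.
  - intros; apply perm_ext. intro; simpl. apply pinvK.
Defined.

(** * Dihedral computations *)

(* [cheb c (k+1)] is the Chebyshev polynomial of the second kind U_(k-1)(c). *)
Fixpoint cheb (c : R) (k : nat) : R :=
  match k with
  | O => -1
  | Datatypes.S k' =>
    match k' with
    | O => 0
    | Datatypes.S k'' => 2 * c * cheb c k' - cheb c k''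
    end
  end.

Lemma cheb_SS (c : R) (k : nat) :
  (cheb c (Datatypes.S (Datatypes.S k)) = 2 * c * cheb c (Datatypes.S k) - cheb c k)%R.
Proof. reflexivity. Qed.

Lemma cheb_one (k : nat) : (cheb 1 k = INR k - 1)%R.
Proof.
  enough (H : (cheb 1 k = INR k - 1 /\ cheb 1 (Datatypes.S k) = INR (Datatypes.S k) - 1)%R) by apply H.
  induction k as [|k [IH1 IH2]]; [simpl; lra|].
  split; [exact IH2|]. rewrite cheb_SS, IH1, IH2, !S_INR. lra.
Qed.

(** Both sides satisfy the same three-term recurrence, by sin(a + x) + sin(a - x) = 2 cos x sin a;
    hence the induction on two consecutive indices. *)
Lemma cheb_cos (x : R) (k : nat) : (sin x * cheb (cos x) k = sin ((INR k - 1) * x))%R.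
Proof.
  enough (H : (sin x * cheb (cos x) k = sin ((INR k - 1) * x) /\
    sin x * cheb (cos x) (Datatypes.S k) = sin ((INR (Datatypes.S k) - 1) * x))%R) by apply H.
  induction k as [|k [IH1 IH2]].
  - simpl. split.
    + replace ((0 - 1) * x)%R with (- x)%R by lra. rewrite sin_neg. lra.
    + replace ((1 - 1) * x)%R with 0%R by lra. rewrite sin_0. lra.
  - split; [exact IH2|]. rewrite cheb_SS.
    replace (sin x * (2 * cos x * cheb (cos x) (Datatypes.S k) - cheb (cos x) k))%R
      with (2 * cos x * (sin x * cheb (cos x) (Datatypes.S k)) - sin x * cheb (cos x) k)%R by ring.
    rewrite IH1, IH2, !S_INR.
    replace ((INR k + 1 + 1 - 1) * x)%R with (INR k * x + x)%R by ring.
    replace ((INR k + 1 - 1) * x)%R with (INR k * x)%R by ring.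
    replace ((INR k - 1) * x)%R with (INR k * x - x)%R by ring.
    rewrite sin_plus, sin_minus. ring.
Qed.

Lemma PI_div_bounds (m : nat) :
  (2 <= m)%nat -> (0 < PI / INR m <= PI / 2)%R.
Proof.
  intro Hm. assert (H2 : (2 <= INR m)%R) by (apply (le_INR 2), Hm).
  pose proof PI_RGT_0. split.
  - apply Rdiv_lt_0_compat; lra.
  - unfold Rdiv. apply Rmult_le_compat_l; [lra|]. apply Rinv_le_contravar; lra.
Qed.

Lemma sin_PI_div_pos (m : nat) : (2 <= m)%nat -> (0 < sin (PI / INR m))%R.
Proof.
  intro Hm. destruct (PI_div_bounds Hm). pose proof PI_RGT_0.
  apply sin_gt_0; lra.
Qed.

(** By [cheb_cos] the value is sin(k pi/m) / sin(pi/m), and for k <= m the angle k pi/m stays within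
    [0, pi]. *)
Lemma cheb_cos_nonneg (m k : nat) :
  (2 <= m)%nat -> (k <= m)%nat -> (0 <= cheb (cos (PI / INR m)) (Datatypes.S k))%R.
Proof.
  intros Hm Hk.
  assert (Hs := sin_PI_div_pos Hm).
  apply Rmult_le_reg_l with (sin (PI / INR m)); [exact Hs|].
  rewrite Rmult_0_r, cheb_cos, S_INR.
  replace ((INR k + 1 - 1) * (PI / INR m))%R with (INR k * (PI / INR m))%R by ring.
  destruct (PI_div_bounds Hm).
  assert (Hm0 : (0 < INR m)%R) by (apply lt_0_INR; lia).
  apply sin_ge_0.
  - apply Rmult_le_pos; [apply pos_INR|lra].
  - replace PI with (INR m * (PI / INR m))%R at 2 by (field; lra).
    apply Rmult_le_compat_r; [lra|]. apply le_INR, Hk.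
Qed.

Fixpoint alt (T : Type) (k : nat) (s t : T) : list T :=
  match k with
  | O => []
  | Datatypes.S k' => s :: alt k' t s
  end.

Lemma alt_length (T : Type) (k : nat) (s t : T) : length (alt k s t) = k.
Proof. revert s t. induction k; intros; simpl; auto. Qed.

Lemma alt_In (T : Type) (k : nat) (s t u : T) : In u (alt k s t) -> u = s \/ u = t.
Proof.
  revert s t. induction k as [|k IH]; intros s t; simpl; [tauto|].
  intros [H|H]; [now left|]. destruct (IH _ _ H); auto.
Qed.

Lemma alt_add (T : Type) (j k : nat) (s t : T) :
  alt (j + k) s t = alt j s t ++ (if Nat.even j then alt k s t else alt k t s).
Proof.
  revert s t. induction j as [|j IH]; intros; [reflexivity|].
  simpl plus. simpl alt. rewrite IH, Nat.even_succ, <- Nat.negb_even.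
  now destruct (Nat.even j).
Qed.

Lemma alt_snoc (T : Type) (k : nat) (s t : T) :
  alt (Datatypes.S k) s t = alt k s t ++ [if Nat.even k then s else t].
Proof. rewrite <- Nat.add_1_r, alt_add. now destruct (Nat.even k). Qed.

(** * Words acting on linear forms *)

Section DualAction.
Context (W : Group).

(* The contragredient of [refl_combo]: functions [W -> R] are linear forms on
   formal combinations. *)
Definition dsig (s : W) (f : W -> R) : W -> R :=
  fun t => (f t - 2 * Bst W s t * f s)%R.

Definition dword (ws : list W) (f : W -> R) : W -> R := fold_right dsig f ws.

Lemma dword_app (l l' : list W) (f : W -> R) : dword (l ++ l') f = dword l (dword l' f).
Proof. apply fold_right_app. Qed.

Lemma dsig_linear (s : W) (a b : R) (f g : W -> R) :
  dsig s (fun t => a * f t + b * g t)%R = (fun t => a * dsig s f t + b * dsig s g t)%R.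
Proof. extensionality t. unfold dsig. ring. Qed.

Lemma dword_linear (ws : list W) (a b : R) (f g : W -> R) :
  dword ws (fun t => a * f t + b * g t)%R = (fun t => a * dword ws f t + b * dword ws g t)%R.
Proof.
  induction ws as [|s ws IH]; [reflexivity|].
  simpl. now rewrite IH, dsig_linear.
Qed.

Lemma dsig_fix (s : W) (f : W -> R) : f s = 0%R -> dsig s f = f.
Proof. intro H. extensionality t. unfold dsig. rewrite H. ring. Qed.

(** The pair of values at [s] and [t] evolves on its own under both reflections. The rightmost
    letter acts first, and it is [t] exactly when [k] is even and positive; [a] is the value of [f]
    there. The induction exchanges [s] and [t]. *)
Lemma dword_alt (s t : W) (c : R) (k : nat) (f : W -> R) :
  Bst W s s = 1%R -> Bst W t t = 1%R -> Bst W s t = (- c)%R -> Bst W t s = (- c)%R ->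
  let a := if Nat.even k then f t else f s in
  let b := if Nat.even k then f s else f t in
  (dword (alt k s t) f t = cheb c (Datatypes.S (Datatypes.S k)) * a + cheb c (Datatypes.S k) * b /\
   dword (alt k s t) f s = - (cheb c (Datatypes.S k) * a + cheb c k * b))%R.
Proof.
  revert s t. induction k as [|k IH]; intros s t Hss Htt Hst Hts a b.
  - unfold a, b. simpl. split; ring.
  - destruct (IH t s Htt Hss Hts Hst) as [IHs IHt].
    assert (Ha : (if Nat.even k then f s else f t) = a).
    { unfold a. rewrite Nat.even_succ, <- Nat.negb_even. now destruct (Nat.even k). }
    assert (Hb : (if Nat.even k then f t else f s) = b).
    { unfold b. rewrite Nat.even_succ, <- Nat.negb_even. now destruct (Nat.even k). }
    rewrite Ha, Hb in IHs, IHt.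
    change (alt (Datatypes.S k) s t) with (s :: alt k t s).
    change (dword (s :: alt k t s) f) with (dsig s (dword (alt k t s) f)).
    unfold dsig. rewrite IHs, IHt, Hst, Hss, !cheb_SS.
    split; ring.
Qed.

(** Only two unknown coefficients describe the change of [f] at all other generators, so it can be
    determined from the values at [s] and [t] alone. *)
Lemma dword_alt_span (s t : W) (k : nat) (f : W -> R) :
  exists x y : R, forall u, (dword (alt k s t) f u = f u + x * Bst W s u + y * Bst W t u)%R.
Proof.
  revert s t. induction k as [|k IH]; intros s t.
  - exists 0%R, 0%R. intro u. simpl. ring.
  - destruct (IH t s) as [x [y H]].
    exists (y - 2 * dword (alt k t s) f s)%R, x.
    intro u. simpl. unfold dsig. rewrite (H u). ring.
Qed.

(** After a full turn of angle 2 pi, [dword_alt] returns the original values at [s] and [t]. The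
    change y B(s,.) + z B(t,.) from [dword_alt_span] thus vanishes at [s] and [t]; the Gram
    determinant of the pair is sin(pi/m)^2 > 0, so y = z = 0. *)
Lemma dword_alt_relation (s t : W) (m : nat) (f : W -> R) : (2 <= m)%nat ->
  Bst W s s = 1%R -> Bst W t t = 1%R ->
  Bst W s t = (- cos (PI / INR m))%R -> Bst W t s = (- cos (PI / INR m))%R ->
  dword (alt (2 * m) s t) f = f.
Proof.
  intros Hm Hss Htt Hst Hts.
  set (x := (PI / INR m)%R) in *. set (k := (2 * m)%nat).
  assert (Hs : (0 < sin x)%R) by now apply sin_PI_div_pos.
  assert (Hm0 : (0 < INR m)%R) by (apply lt_0_INR; lia).
  assert (Hk : (INR k * x = 2 * PI)%R).
  { unfold k, x. rewrite mult_INR. simpl. field. lra. }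
  assert (Hc : forall j z, (sin ((INR j - 1) * x) = sin x * z)%R -> cheb (cos x) j = z).
  { intros j z Hz. apply Rmult_eq_reg_l with (sin x); [|lra]. now rewrite cheb_cos. }
  assert (C0 : cheb (cos x) k = (-1)%R).
  { apply Hc. replace ((INR k - 1) * x)%R with (- x + 2 * INR 1 * PI)%R by (simpl; lra).
    rewrite sin_period, sin_neg. ring. }
  assert (C1 : cheb (cos x) (Datatypes.S k) = 0%R).
  { apply Hc. rewrite S_INR. replace ((INR k + 1 - 1) * x)%R with (0 + 2 * INR 1 * PI)%R by (simpl; lra).
    rewrite sin_period, sin_0. ring. }
  assert (C2 : cheb (cos x) (Datatypes.S (Datatypes.S k)) = 1%R).
  { apply Hc. rewrite !S_INR. replace ((INR k + 1 + 1 - 1) * x)%R with (x + 2 * INR 1 * PI)%R by (simpl; lra).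
    rewrite sin_period. ring. }
  destruct (@dword_alt s t _ k f Hss Htt Hst Hts) as [Et Es].
  replace (Nat.even k) with true in Et, Es by (unfold k; now rewrite Nat.even_even).
  rewrite C0, C1, C2 in *.
  destruct (@dword_alt_span s t k f) as [y [z H]].
  pose proof (H s) as H1. pose proof (H t) as H2.
  rewrite Es, Hss, Hts in H1. rewrite Et, Htt, Hst in H2.
  assert (Hsq : (sin x * sin x + cos x * cos x = 1)%R) by apply sin2_cos2.
  assert (Hy : (y = z * cos x)%R) by lra.
  assert (Hz : (z * (sin x * sin x) = 0)%R).
  { replace (sin x * sin x)%R with (1 - cos x * cos x)%R by lra. rewrite Hy in H2. lra. }
  assert (z = 0)%R.
  { apply Rmult_integral in Hz. destruct Hz as [|Hz]; [assumption|].
    apply Rmult_integral in Hz. lra. }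
  assert (y = 0)%R by (subst z; lra).
  extensionality u. rewrite H. subst y z. lra.
Qed.

End DualAction.

(** * Words and length in a Coxeter group *)

Section Coxeter.
Context (W : Group) (Sg : W -> Prop).
Hypothesis cox : coxeter_system W Sg.
Local Notation "x ** y" := (gmul W x y) (at level 40, left associativity).
Local Notation inv := (ginv W).
Local Notation e := (gone W).
Local Notation prod := (word_prod W).
Local Notation gen := (gen W).

Lemma gens_sq (s : W) : Sg s -> s ** s = e.
Proof. intro Hs. destruct cox as [H _]. now apply H. Qed.

Lemma gens_inv (s : W) : Sg s -> inv s = s.
Proof. intro Hs. apply ginv_unique, gens_sq, Hs. Qed.

Lemma gens_mulK (s x : W) : Sg s -> x ** s ** s = x.
Proof. intro Hs. now rewrite <- gmulA, gens_sq, gmulr1. Qed.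

Lemma gens_Kmul (s x : W) : Sg s -> s ** (s ** x) = x.
Proof. intro Hs. now rewrite gmulA, gens_sq, gmul1. Qed.

Definition over (J : W -> Prop) (ws : list W) : Prop := forall u, In u ws -> J u.

Lemma over_app (J : W -> Prop) (l l' : list W) : over J l -> over J l' -> over J (l ++ l').
Proof. intros H H' u Hu. apply in_app_or in Hu. destruct Hu; auto. Qed.

Lemma over_cons (J : W -> Prop) (s : W) (l : list W) : over J (s :: l) <-> J s /\ over J l.
Proof.
  split.
  - intro H. split; [apply H; now left|]. intros u Hu. apply H. now right.
  - intros [Hs H] u [<-|Hu]; auto.
Qed.

Lemma over_alt (J : W -> Prop) (k : nat) (s t : W) : J s -> J t -> over J (alt k s t).
Proof. intros Hs Ht u Hu. apply alt_In in Hu. now destruct Hu; subst. Qed.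

Lemma over_rev (J : W -> Prop) (l : list W) : over J l -> over J (rev l).
Proof. intros H u Hu. apply H. now apply in_rev. Qed.

Lemma prod_gen (J : W -> Prop) (ws : list W) : over J ws -> gen J (prod ws).
Proof.
  induction ws as [|s ws IH]; intro H; [apply gen_one|].
  apply over_cons in H. apply gen_mul; [now apply gen_incl|]. now apply IH.
Qed.

Lemma prod_rev (ws : list W) : over Sg ws -> prod (rev ws) = inv (prod ws).
Proof.
  induction ws as [|s ws IH]; intro H; simpl; [now rewrite ginv1|].
  apply over_cons in H. destruct H as [Hs H].
  rewrite word_prod_app, IH by assumption. simpl.
  now rewrite gmulr1, ginvM, (gens_inv Hs).
Qed.

Lemma gen_word (J : W -> Prop) (x : W) :
  (forall s, J s -> Sg s) -> gen J x -> exists ws, over J ws /\ prod ws = x.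
Proof.
  intros HJ Hx. apply Hx.
  - repeat split.
    + exists []. split; [intros u []|reflexivity].
    + intros y z [l [Hl <-]] [l' [Hl' <-]]. exists (l ++ l').
      split; [now apply over_app|apply word_prod_app].
    + intros y [l [Hl <-]]. exists (rev l). split; [now apply over_rev|].
      apply prod_rev. intros u Hu. now apply HJ, Hl.
  - intros s Hs. exists [s]. split; [intros u [<-|[]]; exact Hs|apply gmulr1].
Qed.

Lemma reduced_word_exists (w : W) :
  exists ws, (over Sg ws /\ prod ws = w) /\
    forall l, over Sg l /\ prod l = w -> (length ws <= length l)%nat.
Proof. apply exists_minimizer, gen_word; [auto|apply cox]. Qed.

Definition rword (w : W) : list W :=
  proj1_sig (constructive_indefinite_description _ (reduced_word_exists w)).

Definition len (w : W) : nat := length (rword w).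

Lemma rword_spec (w : W) : over Sg (rword w) /\ prod (rword w) = w.
Proof. unfold rword. destruct constructive_indefinite_description as [l H]. apply H. Qed.

Lemma len_prod (ws : list W) : over Sg ws -> (len (prod ws) <= length ws)%nat.
Proof.
  intro H. unfold len, rword. destruct constructive_indefinite_description as [l Hl].
  now apply Hl.
Qed.

Lemma len_one : len e = 0%nat.
Proof. assert (H := @len_prod [] (fun u H => match H with end)). simpl in H. lia. Qed.

Lemma len_eq0 (w : W) : len w = 0%nat -> w = e.
Proof.
  unfold len. destruct (rword_spec w) as [_ H]. intro H0.
  apply length_zero_iff_nil in H0. rewrite H0 in H. now rewrite <- H.
Qed.

Lemma len_mul (x y : W) : (len (x ** y) <= len x + len y)%nat.
Proof.
  destruct (rword_spec x) as [Hx Ex], (rword_spec y) as [Hy Ey].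
  assert (H := len_prod (over_app Hx Hy)).
  now rewrite word_prod_app, Ex, Ey, length_app in H.
Qed.

Lemma len_inv (x : W) : len (inv x) = len x.
Proof.
  assert (H : forall y, (len (inv y) <= len y)%nat).
  { intro y. destruct (rword_spec y) as [Hy Ey].
    assert (H := len_prod (over_rev Hy)).
    now rewrite prod_rev, Ey, length_rev in H. }
  pose proof (H x). pose proof (H (inv x)). rewrite ginvK in *. lia.
Qed.

Lemma len_gen (s : W) : Sg s -> (len s <= 1)%nat.
Proof.
  intro Hs. assert (H := @len_prod [s]). simpl in H. rewrite gmulr1 in H.
  apply H. now intros u [<-|[]].
Qed.

Lemma descent (w : W) : w <> e -> exists s, Sg s /\ (len (w ** s) < len w)%nat.
Proof.
  intro Hw. destruct (rword_spec w) as [H E].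
  destruct (exists_last (l := rword w)) as [l [s El]].
  { intro E0. rewrite E0 in E. now apply Hw. }
  rewrite El in H, E.
  assert (Hs : Sg s) by (apply H, in_or_app; right; now left).
  exists s. split; [exact Hs|].
  rewrite word_prod_app in E. simpl in E. rewrite gmulr1 in E.
  unfold len at 2. rewrite El, length_app. simpl.
  rewrite <- E, gens_mulK by exact Hs.
  assert (len (prod l) <= length l)%nat; [|lia].
  apply len_prod. intros u Hu. apply H, in_or_app. now left.
Qed.

Lemma left_descent (w : W) : w <> e -> exists s, Sg s /\ (len (s ** w) < len w)%nat.
Proof.
  intro Hw. destruct (@descent (inv w)) as [s [Hs H]].
  { intro E. apply Hw. now rewrite <- (ginvK w), E, ginv1. }
  exists s. split; [exact Hs|].
  rewrite <- (len_inv w), <- (len_inv (s ** w)), ginvM, (gens_inv Hs). exact H.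
Qed.

(** * The bilinear form and the dual representation *)

Lemma Bst_order (s t : W) (m : nat) :
  elt_order W (s ** t) m -> Bst W s t = (- cos (PI / INR m))%R.
Proof.
  intro Hm. unfold Bst. destruct excluded_middle_informative as [H|H].
  - destruct constructive_indefinite_description as [n Hn]. simpl.
    now rewrite (elt_order_unique Hn Hm).
  - exfalso. apply H. now exists m.
Qed.

Lemma Bst_infinite (s t : W) :
  ~ (exists m, elt_order W (s ** t) m) -> Bst W s t = (-1)%R.
Proof. intro H. unfold Bst. now destruct excluded_middle_informative. Qed.

Lemma order_sym (s t : W) (m : nat) :
  Sg s -> Sg t -> elt_order W (s ** t) m -> elt_order W (t ** s) m.
Proof.
  intros Hs Ht H. apply elt_order_inv in H.
  now rewrite ginvM, !gens_inv in H.
Qed.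

Lemma Bst_sym (s t : W) : Sg s -> Sg t -> Bst W s t = Bst W t s.
Proof.
  intros Hs Ht. destruct (classic (exists m, elt_order W (s ** t) m)) as [[m Hm]|H].
  - rewrite (Bst_order Hm). now rewrite (Bst_order (order_sym Hs Ht Hm)).
  - rewrite (Bst_infinite H). symmetry. apply Bst_infinite.
    intros [m Hm]. apply H. exists m. now apply order_sym.
Qed.

Lemma order_one (s : W) : Sg s -> elt_order W (s ** s) 1.
Proof.
  intro Hs. repeat split; [lia| |intros; lia].
  simpl. now rewrite gens_sq, gmul1.
Qed.

Lemma Bst_diag (s : W) : Sg s -> Bst W s s = 1%R.
Proof.
  intro Hs. rewrite (Bst_order (order_one Hs)). simpl.
  rewrite Rdiv_1_r, cos_PI. lra.
Qed.

Lemma order_ge2 (s t : W) (m : nat) :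
  Sg s -> Sg t -> s <> t -> elt_order W (s ** t) m -> (2 <= m)%nat.
Proof.
  intros Hs Ht Hst [Hm [E _]].
  destruct m as [|[|m]]; [lia| |lia].
  simpl in E. rewrite gmulr1 in E. exfalso. apply Hst.
  apply ginv_unique in E. now rewrite gens_inv in E.
Qed.

Lemma dsig_invol (s : W) (f : W -> R) : Sg s -> dsig s (dsig s f) = f.
Proof.
  intro Hs. extensionality t. unfold dsig. rewrite (Bst_diag Hs). ring.
Qed.

(** The universal property asks for a function on all of [W], while [dsig s] is known to be an
    involution only for [s] in [Sg]; elsewhere the identity serves as a default. *)
Definition reflection_perm (s : W) : perm (W -> R) :=
  match excluded_middle_informative (Sg s) with
  | left Hs => {| pfun := dsig s; pinv := dsig s;
                  pfunK := fun f => dsig_invol f Hs; pinvK := fun f => dsig_invol f Hs |}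
  | right _ => perm_one _
  end.

Lemma reflection_permE (s : W) (f : W -> R) : Sg s -> reflection_perm s f = dsig s f.
Proof. intro Hs. unfold reflection_perm. now destruct excluded_middle_informative. Qed.

(** This is where the presentation of [W] enters. The relation for distinct generators is
    [dword_alt_relation]; for s = t the order is 1 and the relation is involutivity. *)
Lemma dual_representation :
  exists phi : W -> perm_group (W -> R),
    is_hom W (perm_group (W -> R)) phi /\ forall s, Sg s -> phi s = reflection_perm s.
Proof.
  apply cox. intros s t m Hs Ht Hm. apply perm_ext. intro f.
  assert (E : forall k, gpow (perm_group (W -> R))
      (gmul (perm_group (W -> R)) (reflection_perm s) (reflection_perm t)) k f =
      dword (alt (2 * k) s t) f).
  { induction k as [|k IH]; [reflexivity|].
    replace (2 * Datatypes.S k)%nat with (Datatypes.S (Datatypes.S (2 * k))) by lia.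
    simpl alt. simpl dword. simpl in IH. rewrite <- IH. simpl.
    now rewrite !reflection_permE. }
  rewrite E. simpl pfun.
  destruct (classic (s = t)) as [<-|Hst].
  - rewrite (elt_order_unique Hm (order_one Hs)). simpl. now apply dsig_invol.
  - apply dword_alt_relation; try (now apply Bst_diag).
    + exact (order_ge2 Hs Ht Hst Hm).
    + exact (Bst_order Hm).
    + exact (Bst_order (order_sym Hs Ht Hm)).
Qed.

Definition act (w : W) (f : W -> R) : W -> R := dword (rword w) f.

(** Independence of the chosen reduced word: the homomorphism of [dual_representation] depends on
    the group element only, and any word for it computes its value. *)
Lemma act_prod (ws : list W) (f : W -> R) : over Sg ws -> act (prod ws) f = dword ws f.
Proof.
  destruct dual_representation as [phi [Hphi Hs]].
  assert (H1 : phi e = perm_one _).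
  { assert (H := Hphi e e). rewrite gmul1 in H.
    rewrite <- (gmul1 (perm_group (W -> R)) (phi e)),
      <- (gmulV (perm_group (W -> R)) (phi e)) at 1.
    rewrite <- gmulA, <- H. apply gmulV. }
  assert (H : forall l, over Sg l -> phi (prod l) f = dword l f).
  { induction l as [|s l IH]; intro Hl; simpl; [now rewrite H1|].
    apply over_cons in Hl. destruct Hl as [Hsg Hl].
    rewrite Hphi, (Hs s Hsg). simpl. now rewrite (reflection_permE _ Hsg), IH. }
  intro Hws. unfold act. destruct (rword_spec (prod ws)) as [Hr Er].
  now rewrite <- (H _ Hr), Er, H.
Qed.

Lemma act_mul (x y : W) (f : W -> R) : act (x ** y) f = act x (act y f).
Proof.
  destruct (rword_spec x) as [Hx Ex], (rword_spec y) as [Hy Ey].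
  rewrite <- Ex at 1. rewrite <- Ey at 1.
  rewrite <- word_prod_app, act_prod by now apply over_app.
  apply dword_app.
Qed.

Lemma act_one (f : W -> R) : act e f = f.
Proof. apply (@act_prod []). intros u []. Qed.

Lemma act_gen (s : W) (f : W -> R) : Sg s -> act s f = dsig s f.
Proof.
  intro Hs. rewrite <- (gmulr1 s) at 1. apply (@act_prod [s]).
  now intros u [<-|[]].
Qed.

Lemma act_invK (x : W) (f : W -> R) : act (inv x) (act x f) = f.
Proof. now rewrite <- act_mul, gmulV, act_one. Qed.

Lemma act_fix_inv (x : W) (f : W -> R) : act x f = f -> act (inv x) f = f.
Proof. intro H. rewrite <- H at 1. apply act_invK. Qed.

Lemma act_linear (w : W) (a b : R) (f g : W -> R) :
  act w (fun t => a * f t + b * g t)%R = (fun t => a * act w f t + b * act w g t)%R.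
Proof. apply dword_linear. Qed.

Lemma act_gen_at (s : W) (f : W -> R) : Sg s -> act s f s = (- f s)%R.
Proof. intro Hs. rewrite act_gen by exact Hs. unfold dsig. rewrite Bst_diag by exact Hs. ring. Qed.

Lemma gpow_alt (s t : W) (k : nat) : prod (alt (2 * k) s t) = gpow W (s ** t) k.
Proof.
  induction k as [|k IH]; [reflexivity|].
  replace (2 * Datatypes.S k)%nat with (Datatypes.S (Datatypes.S (2 * k))) by lia.
  simpl alt. simpl prod. simpl in IH. simpl gpow. rewrite IH. apply gmulA.
Qed.

(** Since (ts)^j is the inverse of (st)^j, the sides are (st)^j and (st)^(-j) when m = 2j, and s
    (st)^(-j) and t (st)^j when m = 2j + 1. *)
Lemma braid_relation (s t : W) (m : nat) :
  Sg s -> Sg t -> gpow W (s ** t) m = e -> prod (alt m s t) = prod (alt m t s).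
Proof.
  intros Hs Ht Hm.
  assert (Hinv : forall j, gpow W (t ** s) j = inv (gpow W (s ** t) j)).
  { intro j. rewrite <- gpow_inv. now rewrite ginvM, !gens_inv. }
  destruct (Nat.Even_or_Odd m) as [[j ->]|[j ->]].
  - rewrite !gpow_alt, Hinv. symmetry. apply ginv_unique.
    replace (2 * j)%nat with (j + j)%nat in Hm by lia. now rewrite gpow_add in Hm.
  - rewrite !Nat.add_1_r. simpl alt. simpl prod.
    change (j + (j + 0))%nat with (2 * j)%nat. rewrite !gpow_alt, Hinv.
    replace (2 * j + 1)%nat with (Datatypes.S (j + j)) in Hm by lia.
    simpl in Hm. rewrite gpow_add, gmulA in Hm.
    apply ginv_unique in Hm. rewrite <- (ginvK (gpow W (s ** t) j)) in Hm at 2.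
    assert (E : s ** t ** gpow W (s ** t) j = inv (gpow W (s ** t) j)).
    { now rewrite <- (ginvK (s ** t ** _)), Hm, ginvK. }
    rewrite <- E, <- gmulA. now apply gens_Kmul.
Qed.

(** * Positivity of roots *)

(* The root [w(alpha_s)], as a linear form on the dual, is
   [fun f => act (inv w) f s]; its [x]-coordinate is the value at [delta x]. *)
Definition nonneg_root (w s : W) : Prop :=
  forall f, (forall t, Sg t -> 0 <= f t)%R -> (0 <= act (inv w) f s)%R.

(* Strip from [w] a maximal alternating suffix in [s], [t]; the remaining
   prefix [v] satisfies the hypothesis for both [s] and [t], and the dihedral
   computation expresses [w(alpha_s)] through [v(alpha_s)] and [v(alpha_t)]
   with nonnegative coefficients. *)
Lemma nonneg_root_of_len (w s : W) :
  Sg s -> (len w <= len (w ** s))%nat -> nonneg_root w s.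
Proof.
  revert s. remember (len w) as n eqn:En. revert w En.
  induction n as [n IH] using lt_wf_ind. intros w -> s Hs Hlen.
  destruct (classic (w = e)) as [->|Hw].
  { intros f Hf. rewrite ginv1, act_one. now apply Hf. }
  destruct (descent Hw) as [t [Ht Hdesc]].
  assert (Hst : s <> t) by (intros <-; lia).
  destruct (@exists_maximizer nat
    (fun k => len (w ** prod (alt k t s)) + k <= len w)%nat (fun k => k) (len w))
    as [k [Hk Hmax]].
  { exists 1%nat. simpl. rewrite gmulr1. lia. }
  { intros; lia. }
  set (v := w ** prod (alt k t s)) in *.
  assert (Hk1 : (1 <= k)%nat) by (apply Hmax; simpl; rewrite gmulr1; lia).
  assert (Hov : forall j, over Sg (alt j t s)) by (intro; now apply over_alt).
  (* Stripping [j] letters lowers the length by at most [j], so the inequality selecting [k] is an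
     equality. *)
  assert (Hlb : forall j, (len w <= len (w ** prod (alt j t s)) + j)%nat).
  { intro j.
    assert (H := len_mul (w ** prod (alt j t s)) (inv (prod (alt j t s)))).
    rewrite <- gmulA, gmulVr, gmulr1, len_inv in H.
    pose proof (len_prod (Hov j)) as H'. rewrite alt_length in H'. lia. }
  assert (Hv : (len v + k = len w)%nat) by (specialize (Hlb k); fold v in Hlb; lia).
  (* Maximality of [k] handles one of the two letters. The other one is the letter stripped last,
     and putting it back lengthens [v]. *)
  assert (Hnext : (len v <= len (v ** (if Nat.even k then t else s)))%nat).
  { destruct (le_lt_dec (len v) (len (v ** (if Nat.even k then t else s)))) as [|Hlt]; [assumption|].
    exfalso. enough (Datatypes.S k <= k)%nat by lia. apply Hmax.
    rewrite alt_snoc, word_prod_app. simpl prod. rewrite gmulr1, gmulA. fold v. lia. }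
  assert (Hprev : (len v <= len (v ** (if Nat.even k then s else t)))%nat).
  { destruct k as [|k']; [lia|].
    assert (E : v ** (if Nat.even (Datatypes.S k') then s else t) = w ** prod (alt k' t s)).
    { unfold v. rewrite alt_snoc, word_prod_app. simpl prod.
      rewrite gmulr1, gmulA, Nat.even_succ, <- Nat.negb_even.
      destruct (Nat.even k'); now apply gens_mulK. }
    rewrite E. specialize (Hlb k'). lia. }
  assert (Hpos : nonneg_root v s /\ nonneg_root v t).
  { split; (apply (IH (len v)); [lia|reflexivity|assumption|]); now destruct (Nat.even k). }
  (* If m <= k, the braid relation makes two letters cancel in the alternating word of length k + 1,
     so [w ** s] would be shorter than [w]. *)
  assert (Hord : forall m, elt_order W (t ** s) m -> (k < m)%nat).
  { intros m Hm. destruct (le_lt_dec m k) as [Hmk|]; [exfalso|assumption].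
    assert (Ews : w ** s = v ** inv (prod (alt (Datatypes.S k) s t))).
    { simpl. unfold v. rewrite ginvM, (gens_inv Hs). gsimp. reflexivity. }
    assert (Hl : (len (prod (alt (Datatypes.S k) s t)) < k)%nat).
    { replace (Datatypes.S k) with (Datatypes.S m + (k - m))%nat by lia.
      rewrite alt_add, word_prod_app.
      set (l := if Nat.even (Datatypes.S m) then _ else _).
      assert (Hl : (len (prod l) <= k - m)%nat).
      { unfold l. destruct (Nat.even (Datatypes.S m));
          (eapply Nat.le_trans; [now apply len_prod, over_alt|now rewrite alt_length]). }
      assert (Hm' : (len (prod (alt (Datatypes.S m) s t)) < m)%nat).
      { destruct Hm as [Hm0 [Em _]].
        simpl. rewrite (braid_relation Ht Hs Em).
        destruct m as [|m]; [lia|]. simpl. rewrite gens_Kmul by exact Hs.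
        assert (H := @len_prod (alt m t s)). rewrite alt_length in H.
        specialize (H (Hov m)). lia. }
      pose proof (len_mul (prod (alt (Datatypes.S m) s t)) (prod l)). lia. }
    pose proof (len_mul v (inv (prod (alt (Datatypes.S k) s t)))) as H.
    rewrite <- Ews, len_inv in H. lia. }
  intros f Hf.
  replace (inv w) with (prod (alt k t s) ** inv v).
  2:{ unfold v. group. }
  rewrite act_mul, act_prod by apply Hov.
  set (g := act (inv v) f).
  assert (Hg : (0 <= g s)%R /\ (0 <= g t)%R) by (split; now apply Hpos).
  (* For infinite order c = 1, and the Chebyshev values grow linearly; for order [m] the bound k < m
     keeps them nonnegative. *)
  assert (Hc : exists c, Bst W t s = (- c)%R /\
    (0 <= cheb c (Datatypes.S k))%R /\ (0 <= cheb c (Datatypes.S (Datatypes.S k)))%R).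
  { destruct (classic (exists m, elt_order W (t ** s) m)) as [[m Hm]|Hinf].
    - exists (cos (PI / INR m)). split; [now apply Bst_order|].
      assert (Hm2 := order_ge2 Ht Hs (not_eq_sym Hst) Hm). specialize (Hord m Hm).
      split; apply cheb_cos_nonneg; lia.
    - exists 1%R. split; [now apply Bst_infinite|].
      rewrite !cheb_one, !S_INR. pose proof (pos_INR k). lra. }
  destruct Hc as [c [Hc [C1 C2]]].
  assert (Hc' : Bst W s t = (- c)%R) by now rewrite Bst_sym.
  destruct (@dword_alt W t s c k g (Bst_diag Ht) (Bst_diag Hs) Hc Hc') as [-> _].
  destruct (Nat.even k); apply Rplus_le_le_0_compat; apply Rmult_le_pos; apply Hg || assumption.
Qed.

Lemma nonneg_root_gen_mul (w s : W) (f : W -> R) :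
  Sg s -> act (inv (w ** s)) f s = (- act (inv w) f s)%R.
Proof. intro Hs. now rewrite ginvM, (gens_inv Hs), act_mul, act_gen_at. Qed.

Lemma root_sign (w s : W) : Sg s ->
  nonneg_root w s \/ nonneg_root (w ** s) s.
Proof.
  intro Hs. destruct (le_lt_dec (len w) (len (w ** s))) as [H|H].
  - left. now apply nonneg_root_of_len.
  - right. apply nonneg_root_of_len; [exact Hs|]. rewrite gens_mulK by exact Hs. lia.
Qed.

(** * Coordinates of roots *)

Definition delta (x y : W) : R := if excluded_middle_informative (y = x) then 1%R else 0%R.

Lemma delta_same (x : W) : delta x x = 1%R.
Proof. unfold delta. now destruct excluded_middle_informative. Qed.

Lemma delta_diff (x y : W) : y <> x -> delta x y = 0%R.
Proof. intro H. unfold delta. now destruct excluded_middle_informative. Qed.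

Lemma delta_nonneg (x y : W) : (0 <= delta x y)%R.
Proof. unfold delta. destruct excluded_middle_informative; lra. Qed.

Definition pairing (f : W -> R) (l : list (R * W)) : R :=
  fold_right (fun p acc => fst p * f (snd p) + acc)%R 0%R l.

Lemma fsum_pairing (l : list (R * W)) (x : W) : fsum W l x = pairing (delta x) l.
Proof.
  induction l as [|p l IH]; [reflexivity|]. simpl. rewrite IH. unfold delta at 2.
  destruct excluded_middle_informative; ring.
Qed.

Lemma pairing_refl_combo (f : W -> R) (s : W) (l : list (R * W)) :
  pairing f (refl_combo W s l) = pairing (dsig s f) l.
Proof.
  simpl. induction l as [|p l IH]; simpl; [ring|].
  rewrite <- IH. unfold dsig. ring.
Qed.

(** Moving each reflection across the pairing reverses the word, which accounts for the inverse. *)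
Lemma pairing_root (f : W -> R) (ws : list W) (s : W) : over Sg ws ->
  pairing f (fold_right (refl_combo W) [(1%R, s)] ws) = act (inv (prod ws)) f s.
Proof.
  intro H. rewrite <- prod_rev, act_prod by (try apply over_rev; assumption).
  revert f. induction ws as [|t ws IH]; intro f; simpl; [ring|].
  apply over_cons in H. rewrite dword_app. simpl.
  rewrite <- IH by apply (proj2 H). apply pairing_refl_combo.
Qed.

Lemma lsum_delta (D : list W) (a : W) (c : R) (f : W -> R) : NoDup D -> In a D ->
  lsum D (fun x => c * delta x a * f x)%R = (c * f a)%R.
Proof.
  intros HD Ha. destruct (in_split _ _ Ha) as [D1 [D2 ->]].
  apply NoDup_remove_2 in HD.
  assert (E : forall D', ~ In a D' -> lsum D' (fun x => c * delta x a * f x)%R = 0%R).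
  { intros D' Hn. apply lsum_zero. intros x Hx. rewrite delta_diff; [ring|].
    intros ->. contradiction. }
  assert (Happ : forall D1 D2 (g : W -> R), lsum (D1 ++ D2) g = (lsum D1 g + lsum D2 g)%R).
  { clear. intros D1 D2 g. induction D1 as [|b D1 IH]; simpl; [ring|]. rewrite IH. ring. }
  rewrite Happ. simpl. rewrite !E, delta_same; [ring| |];
    intro H; apply HD, in_or_app; tauto.
Qed.

Lemma pairing_fsum (f : W -> R) (l : list (R * W)) (D : list W) :
  NoDup D -> incl (map snd l) D -> pairing f l = lsum D (fun x => fsum W l x * f x)%R.
Proof.
  intros HD. induction l as [|[c a] l IH]; intro H.
  - symmetry. apply lsum_zero. intros. simpl. ring.
  - change (pairing f ((c, a) :: l)) with (c * f a + pairing f l)%R.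
    rewrite IH by (intros x Hx; apply H; now right).
    rewrite <- (lsum_delta c f HD) by (apply H; now left).
    rewrite <- lsum_add. apply lsum_ext. intros x _. simpl. unfold delta.
    destruct excluded_middle_informative; ring.
Qed.

Lemma over_root (ws : list W) (s : W) : over Sg ws -> Sg s ->
  over Sg (map snd (fold_right (refl_combo W) [(1%R, s)] ws)).
Proof.
  intros H Hs. induction ws as [|t ws IH]; simpl.
  - now intros u [<-|[]].
  - apply over_cons in H. destruct H as [Ht H]. apply over_cons. split; [exact Ht|]. now apply IH.
Qed.

(** A root is a finite combination of simple roots, so sign information on its coordinates passes to
    its values on arbitrary forms. *)
Lemma root_expansion (w s : W) : Sg s ->
  exists D, over Sg D /\
    forall f, act (inv w) f s = lsum D (fun x => act (inv w) (delta x) s * f x)%R.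
Proof.
  intro Hs. destruct (rword_spec w) as [Hw Ew].
  set (l := fold_right (refl_combo W) [(1%R, s)] (rword w)).
  destruct (list_NoDup (map snd l)) as [D [HD HDl]].
  exists D. split.
  { intros x Hx. apply (over_root Hw Hs). now apply HDl. }
  assert (E : forall f, act (inv w) f s = pairing f l).
  { intro f. unfold l. now rewrite pairing_root, Ew. }
  intro f. rewrite E, (pairing_fsum f HD).
  - apply lsum_ext. intros x _. now rewrite E, fsum_pairing.
  - intros x Hx. now apply HDl.
Qed.

Lemma root_ext (w w' s s' : W) : Sg s -> Sg s' ->
  (forall x, act (inv w) (delta x) s = act (inv w') (delta x) s') ->
  forall f, act (inv w) f s = act (inv w') f s'.
Proof.
  intros Hs Hs' H f.
  destruct (rword_spec w) as [Hw Ew], (rword_spec w') as [Hw' Ew'].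
  set (l := fold_right (refl_combo W) [(1%R, s)] (rword w)).
  set (l' := fold_right (refl_combo W) [(1%R, s')] (rword w')).
  assert (E : forall f, act (inv w) f s = pairing f l).
  { intro g. unfold l. now rewrite pairing_root, Ew. }
  assert (E' : forall f, act (inv w') f s' = pairing f l').
  { intro g. unfold l'. now rewrite pairing_root, Ew'. }
  destruct (list_NoDup (map snd l ++ map snd l')) as [D [HD HDl]].
  rewrite E, E', (pairing_fsum f HD), (pairing_fsum f HD).
  - apply lsum_ext. intros x _. now rewrite !fsum_pairing, <- E, <- E', H.
  - intros x Hx. apply HDl, in_or_app. now right.
  - intros x Hx. apply HDl, in_or_app. now left.
Qed.

Lemma nonneg_root_coords (w s : W) : Sg s ->
  (forall x, 0 <= act (inv w) (delta x) s)%R -> nonneg_root w s.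
Proof.
  intros Hs H f Hf. destruct (root_expansion w Hs) as [D [HD ->]].
  apply lsum_nonneg. intros x Hx. apply Rmult_le_pos; auto.
Qed.

Lemma coords_nonneg_root (w s x : W) :
  nonneg_root w s -> (0 <= act (inv w) (delta x) s)%R.
Proof. intro H. apply H. intros. apply delta_nonneg. Qed.

(** A point in the interior of the fundamental chamber: its value on a root is never 0 and tells
    whether the root is positive. *)
Definition ones (x : W) : R := 1%R.

(** Were the value 0, all coordinates would vanish and the root would be the zero functional; but it
    takes the value 1 on the translate [act w ones]. *)
Lemma nonneg_root_ones (w s : W) : Sg s -> nonneg_root w s -> (0 < act (inv w) ones s)%R.
Proof.
  intros Hs H.
  assert (H1 : (0 <= act (inv w) ones s)%R) by (apply H; intros; unfold ones; lra).
  destruct (Req_dec (act (inv w) ones s) 0) as [E|]; [exfalso|lra].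
  destruct (root_expansion w Hs) as [D [HD HE]].
  rewrite HE in E.
  assert (Z := fun H => lsum_nonneg_eq0 H E).
  assert (C : act (inv w) (act w ones) s = 0%R).
  { rewrite HE. apply lsum_zero. intros x Hx. specialize (Z (fun y _ =>
      Rmult_le_pos _ _ (@coords_nonneg_root w s y H) Rle_0_1) x Hx).
    unfold ones in Z at 1. simpl in Z. rewrite Rmult_1_r in Z. rewrite Z. ring. }
  rewrite act_invK in C. unfold ones in C. lra.
Qed.

Lemma nonneg_root_mul (w s : W) : Sg s -> nonneg_root (w ** s) s -> ~ nonneg_root w s.
Proof.
  intros Hs H H'. apply (nonneg_root_ones Hs) in H, H'.
  rewrite nonneg_root_gen_mul in H by exact Hs. lra.
Qed.

Lemma len_of_nonneg_root (w s : W) :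
  Sg s -> nonneg_root w s -> (len w < len (w ** s))%nat.
Proof.
  intros Hs H. destruct (le_lt_dec (len (w ** s)) (len w)) as [Hl|]; [exfalso|assumption].
  apply (@nonneg_root_mul w s Hs); [|exact H].
  apply nonneg_root_of_len; [exact Hs|]. now rewrite gens_mulK.
Qed.

Lemma nonpos_root (w s : W) (f : W -> R) : Sg s -> ~ nonneg_root w s ->
  (forall t, Sg t -> 0 <= f t)%R -> (act (inv w) f s <= 0)%R.
Proof.
  intros Hs H Hf. destruct (@root_sign w s Hs) as [|H']; [contradiction|].
  specialize (H' f Hf). rewrite nonneg_root_gen_mul in H' by exact Hs. lra.
Qed.

Lemma descent_nonpos_root (w s : W) (f : W -> R) : Sg s -> (len (w ** s) < len w)%nat ->
  (forall t, Sg t -> 0 <= f t)%R -> (act (inv w) f s <= 0)%R.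
Proof.
  intros Hs H. apply nonpos_root; [exact Hs|].
  intro H'. apply len_of_nonneg_root in H'; [lia|exact Hs].
Qed.

Lemma len_of_negative (w s : W) : Sg s -> (act (inv w) ones s < 0)%R ->
  (len (w ** s) < len w)%nat.
Proof.
  intros Hs H. destruct (le_lt_dec (len w) (len (w ** s))) as [Hl|]; [exfalso|assumption].
  apply (nonneg_root_of_len Hs), (nonneg_root_ones Hs) in Hl. lra.
Qed.

Lemma act_ones_nonzero (w s : W) : Sg s -> act w ones s <> 0%R.
Proof.
  intros Hs. rewrite <- (ginvK w). destruct (@root_sign (inv w) s Hs) as [H|H];
    apply (nonneg_root_ones Hs) in H; [lra|].
  rewrite nonneg_root_gen_mul in H by exact Hs. lra.
Qed.

(** A right descent [s] of a nontrivial [w] would make the value of w(alpha_s) on [ones]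
    nonpositive, yet [ones] being fixed that value is 1. *)
Lemma act_faithful (w : W) : (forall f, act w f = f) -> w = e.
Proof.
  intro H. apply NNPP. intro Hw. destruct (descent Hw) as [s [Hs Hl]].
  assert (C : (act (inv w) ones s <= 0)%R).
  { apply descent_nonpos_root; [exact Hs|exact Hl|]. intros. unfold ones. lra. }
  rewrite (act_fix_inv (H ones)) in C. unfold ones in C. lra.
Qed.

(** * Standard parabolic subgroups and stabilisers *)

Lemma gen_fix (J : W -> Prop) (u : W) (f : W -> R) :
  (forall s, J s -> Sg s) -> (forall s, J s -> f s = 0%R) -> gen J u -> act u f = f.
Proof.
  intros HJ Hf Hu. apply Hu.
  - repeat split.
    + apply act_one.
    + intros x y Hx Hy. now rewrite act_mul, Hy.
    + intros x Hx. now apply act_fix_inv.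
  - intros s Hs. rewrite act_gen by auto. apply dsig_fix. auto.
Qed.

(** Allows a form to be altered outside [J], so that results on forms nonnegative on all of [Sg]
    apply to forms nonnegative on [J]. *)
Lemma gen_agree (J : W -> Prop) (u : W) (f g : W -> R) :
  (forall s, J s -> Sg s) -> (forall s, J s -> f s = g s) -> gen J u ->
  forall s, J s -> act u f s = act u g s.
Proof.
  intros HJ Hfg Hu s Hs. destruct (gen_word HJ Hu) as [ws [Hws <-]].
  assert (Hov : over Sg ws) by (intros t Ht; auto).
  rewrite !act_prod by exact Hov. clear Hu Hov. revert s Hs.
  induction ws as [|t ws IH]; intros s Hs; simpl; [auto|].
  apply over_cons in Hws. destruct Hws as [Ht Hws]. unfold dsig.
  now rewrite (IH Hws s Hs), (IH Hws t Ht).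
Qed.

(** If [s] were outside [J], then W_J would fix [delta s], and u(alpha_s) would have [s]-coordinate
    1 although it is nonpositive. *)
Lemma gen_descent (J : W -> Prop) (u s : W) : (forall s, J s -> Sg s) ->
  gen J u -> Sg s -> (len (u ** s) < len u)%nat -> J s.
Proof.
  intros HJ Hu Hs Hl. apply NNPP. intro Hn.
  assert (H : (act (inv u) (delta s) s <= 0)%R).
  { apply descent_nonpos_root; [exact Hs|exact Hl|]. intros. apply delta_nonneg. }
  rewrite (gen_fix HJ) in H.
  - rewrite delta_same in H. lra.
  - intros t Ht. apply delta_diff. intros ->. contradiction.
  - now apply gen_inv.
Qed.

(** For a right descent [s] of [u], the value of u(alpha_s) on [f] is nonpositive and, [u] fixing
    [f], equals [f s]. Hence f s = 0, and [u ** s] is a shorter element fixing [f]. *)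
Lemma stabiliser_gen (J : W -> Prop) (f : W -> R) (u : W) :
  (forall s, J s -> Sg s) -> (forall s, J s -> 0 <= f s)%R ->
  gen J u -> act u f = f -> gen (fun s => J s /\ f s = 0%R) u.
Proof.
  intros HJ Hf. remember (len u) as n eqn:En. revert u En.
  induction n as [n IH] using lt_wf_ind. intros u -> Hu Hfix.
  destruct (classic (u = e)) as [->|Hne]; [apply gen_one|].
  destruct (descent Hne) as [s [Hs Hl]].
  assert (Js : J s) by exact (gen_descent HJ Hu Hs Hl).
  set (g := fun x => if excluded_middle_informative (J x) then f x else 0%R).
  assert (Hneg : (act (inv u) g s <= 0)%R).
  { apply descent_nonpos_root; [exact Hs|exact Hl|]. intros t _. unfold g.
    destruct excluded_middle_informative; [auto|lra]. }
  assert (E : act (inv u) g s = act (inv u) f s).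
  { apply (gen_agree HJ); [|now apply gen_inv|exact Js].
    intros t Ht. unfold g. now destruct excluded_middle_informative. }
  rewrite E, (act_fix_inv Hfix) in Hneg.
  assert (E0 : f s = 0%R) by (specialize (Hf s Js); lra).
  rewrite <- (gens_mulK u Hs). apply gen_mul; [|now apply gen_incl].
  apply (IH (len (u ** s))); [exact Hl|reflexivity| |].
  - apply gen_mul; [exact Hu|now apply gen_incl].
  - now rewrite act_mul, (act_gen f Hs), (dsig_fix E0).
Qed.

Definition parabolic (P : W -> Prop) : Prop :=
  exists w J, (forall s, J s -> Sg s) /\ forall x, P x <-> gen J (inv w ** x ** w).

Lemma parabolic_subgroup (P : W -> Prop) : parabolic P -> subgroup W P.
Proof.
  intros [w [J [_ HP]]]. destruct (subgroup_conj w (gen_subgroup J)) as [H1 [HM HV]].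
  repeat split.
  - now apply HP.
  - intros x y Hx Hy. apply HP, HM; now apply HP.
  - intros x Hx. now apply HP, HV, HP.
Qed.

(** A dominant form whose stabiliser is exactly W_K. *)
Definition off (K : W -> Prop) (x : W) : R := if excluded_middle_informative (K x) then 0%R else 1%R.

Lemma off_nonneg (K : W -> Prop) (x : W) : (0 <= off K x)%R.
Proof. unfold off. destruct excluded_middle_informative; lra. Qed.

Lemma off_eq0 (K : W -> Prop) (x : W) : off K x = 0%R <-> K x.
Proof. unfold off. destruct excluded_middle_informative; split; intro; (tauto || lra). Qed.

Lemma gen_stabiliser_off (K : W -> Prop) (x : W) :
  (forall s, K s -> Sg s) -> gen K x <-> act x (off K) = off K.
Proof.
  intro HK. split; intro H.
  - apply (gen_fix HK); [|exact H]. intros s Hs. now apply off_eq0.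
  - apply (@stabiliser_gen Sg) in H; [|auto|intros; apply off_nonneg|apply cox].
    revert H. apply gen_mono. intros y [_ Hy]. apply gen_incl. now apply off_eq0.
Qed.

(* [Q] is the stabiliser of a translate of [off K]; translating further by an
   element of [W_J] of minimal length makes that form nonnegative on [J]. *)
Lemma parabolic_inter (P Q : W -> Prop) :
  parabolic P -> parabolic Q -> parabolic (fun x => P x /\ Q x).
Proof.
  intros [w [J [HJ HP]]] [v [K [HK HQ]]].
  destruct (@exists_minimizer W (gen J) (fun u => len (u ** (inv w ** v)))) as [u [Hu Hmin]].
  { exists e. apply gen_one. }
  set (a := u ** (inv w ** v)) in *.
  set (f := act a (off K)).
  assert (Hf : forall s, J s -> (0 <= f s)%R).
  (* By the minimal choice of [u], left multiplication by [s] does not shorten [a]; thus the inverse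
     of [a] sends alpha_s to a positive root. *)
  { intros s Hs. unfold f. rewrite <- (ginvK a). apply nonneg_root_of_len; [auto| |].
    - rewrite len_inv. rewrite <- (len_inv (inv a ** s)), ginvM, ginvK, gens_inv by auto.
      replace (s ** a) with (s ** u ** (inv w ** v)) by (unfold a; group).
      apply Hmin, gen_mul; [now apply gen_incl|exact Hu].
    - intros. apply off_nonneg. }
  assert (HQf : forall x, Q x <-> act (u ** inv w ** x ** w ** inv u) f = f).
  { intro x. rewrite HQ, gen_stabiliser_off by exact HK.
    replace (u ** inv w ** x ** w ** inv u) with (a ** (inv v ** x ** v) ** inv a)
      by (unfold a; group).
    unfold f. rewrite !act_mul, act_invK. split; intro H; [now rewrite H|].
    apply (f_equal (act (inv a))) in H. now rewrite !act_invK in H. }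
  exists (w ** inv u), (fun s => J s /\ f s = 0%R). split; [firstorder|].
  intro x. rewrite HP, HQf.
  replace (inv (w ** inv u) ** x ** (w ** inv u)) with (u ** inv w ** x ** w ** inv u) by group.
  split.
  - intros [H1 H2]. apply stabiliser_gen; try assumption.
    replace (u ** inv w ** x ** w ** inv u) with (u ** (inv w ** x ** w) ** inv u) by group.
    apply gen_mul; [now apply gen_mul|now apply gen_inv].
  - intro H.
    assert (H' : gen J (u ** inv w ** x ** w ** inv u)).
    { revert H. apply gen_mono. intros y [Hy _]. now apply gen_incl. }
    split.
    + replace (inv w ** x ** w) with (inv u ** (u ** inv w ** x ** w ** inv u) ** u) by group.
      apply gen_mul; [|exact Hu]. apply gen_mul; [now apply gen_inv|exact H'].
    + apply (gen_fix (J := fun s => J s /\ f s = 0%R)); [firstorder|now intros s []|exact H].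
Qed.

(** * Finite subgroups lie in finite parabolic subgroups *)

Definition is_finite (P : W -> Prop) : Prop := exists l : list W, forall x, P x -> In x l.

Definition orbit_sum (X : list W) : W -> R := fun t => lsum X (fun x => act x ones t).

Lemma act_orbit_sum (u : W) (X : list W) :
  act u (orbit_sum X) = orbit_sum (map (fun x => u ** x) X).
Proof.
  induction X as [|x X IH].
  - assert (H := act_linear u 0 0 (orbit_sum []) (orbit_sum [])).
    replace (fun t => (0 * orbit_sum [] t + 0 * orbit_sum [] t)%R) with (orbit_sum []) in H.
    + simpl. rewrite H. extensionality t. unfold orbit_sum. simpl. ring.
    + extensionality t. unfold orbit_sum. simpl. ring.
  - assert (H := act_linear u 1 1 (act x ones) (orbit_sum X)).
    replace (fun t => (1 * act x ones t + 1 * orbit_sum X t)%R) with (orbit_sum (x :: X)) in H.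
    + rewrite H, IH. extensionality t. unfold orbit_sum. simpl. rewrite act_mul. ring.
    + extensionality t. unfold orbit_sum. simpl. ring.
Qed.

Lemma orbit_sum_perm (X Y : list W) : Permutation X Y -> orbit_sum X = orbit_sum Y.
Proof.
  intro H. extensionality t. unfold orbit_sum.
  induction H; simpl; try lra.
Qed.

Lemma orbit_sum_invariant (F : list W) (H : W -> Prop) (h : W) :
  subgroup W H -> NoDup F -> (forall x, In x F <-> H x) -> H h ->
  act h (orbit_sum F) = orbit_sum F.
Proof.
  intros [_ [HM HV]] HF HFH Hh. rewrite act_orbit_sum. apply orbit_sum_perm.
  apply NoDup_Permutation; [|exact HF|].
  - apply FinFun.Injective_map_NoDup; [|exact HF].
    intros x y E. apply (f_equal (gmul W (inv h))) in E. now rewrite !gmulVK in E.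
  - intro x. rewrite in_map_iff. split.
    + intros [y [<- Hy]]. apply HFH, HM; [exact Hh|now apply HFH].
    + intro Hx. exists (inv h ** x). split; [apply gmulKV|].
      apply HFH, HM; [now apply HV|now apply HFH].
Qed.

(* [len u + len x - len (u x)] is twice the number of inversions of [u] that
   are cancelled in [u x], hence at most [2 len x]. *)
Definition cancel (X : list W) (u : W) : nat :=
  list_sum (map (fun x => len u + len x - len (u ** x))%nat X).

Lemma cancel_bound (X : list W) (u : W) :
  (cancel X u <= list_sum (map (fun x => 2 * len x) X))%nat.
Proof.
  induction X as [|x X IH]; [auto|]. unfold cancel in *. simpl map. simpl list_sum.
  assert (H := len_mul (u ** x) (inv x)). rewrite <- gmulA, gmulVr, gmulr1, len_inv in H.
  simpl in *. lia.
Qed.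

Lemma act_ones_neg_len (u s : W) : Sg s -> (act u ones s < 0)%R -> (len (s ** u) < len u)%nat.
Proof.
  intros Hs H. rewrite <- (ginvK u) in H. apply (len_of_negative Hs) in H.
  rewrite len_inv, <- (len_inv (inv u ** s)), ginvM, ginvK, (gens_inv Hs) in H. exact H.
Qed.

(** No term decreases, because [len (s ** u ** x)] exceeds [len (u ** x)] by at most 1. A term for
    which [s] is a left descent of [u ** x] increases strictly. *)
Lemma cancel_step (X : list W) (u s : W) : Sg s -> (len u < len (s ** u))%nat ->
  (exists x, In x X /\ (act (u ** x) ones s < 0)%R) -> (cancel X u < cancel X (s ** u))%nat.
Proof.
  intros Hs Hl.
  assert (Hterm : forall x, (len u + len x - len (u ** x) <= len (s ** u) + len x - len (s ** u ** x))%nat).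
  { intro x. pose proof (len_mul s (u ** x)). pose proof (len_gen Hs). rewrite <- gmulA. lia. }
  assert (Hle : forall X, (cancel X u <= cancel X (s ** u))%nat).
  { intro Y. unfold cancel. induction Y as [|y Y IH]; simpl; [lia|]. specialize (Hterm y). lia. }
  intros [x [Hx Hn]]. apply (act_ones_neg_len Hs) in Hn.
  induction X as [|y X IH]; [destruct Hx|].
  unfold cancel in *. simpl map. simpl list_sum. destruct Hx as [->|Hx].
  - specialize (Hle X). pose proof (len_mul u x). rewrite <- !gmulA. lia.
  - specialize (IH Hx). specialize (Hterm y). lia.
Qed.

(** The summands are nonzero by [act_ones_nonzero], so a nonempty sum that is not positive has a
    negative summand. *)
Lemma orbit_sum_exists_neg (X : list W) (u s : W) : Sg s -> X <> [] ->
  (act u (orbit_sum X) s <= 0)%R -> exists x, In x X /\ (act (u ** x) ones s < 0)%R.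
Proof.
  intros Hs HX H. apply NNPP. intro Hn.
  rewrite act_orbit_sum in H. unfold orbit_sum in H.
  assert (Hpos : forall x, In x X -> (0 < act (u ** x) ones s)%R).
  { intros x Hx. pose proof (@act_ones_nonzero (u ** x) s Hs).
    destruct (Rlt_le_dec (act (u ** x) ones s) 0); [|lra]. exfalso. apply Hn. now exists x. }
  destruct X as [|x X]; [now apply HX|]. simpl in H.
  assert (0 < act (u ** x) ones s)%R by (apply Hpos; now left).
  assert (0 <= lsum (map (fun x => u ** x) X) (fun x => act x ones s))%R; [|lra].
  apply lsum_nonneg. intros y Hy. apply in_map_iff in Hy. destruct Hy as [z [<- Hz]].
  left. apply Hpos. now right.
Qed.

(* [s] changes only the [s]-coordinate, so a positive root made negative by
   [s] is supported on [s]. *)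
Lemma root_flipped_by_gen (y s t : W) : Sg s -> Sg t ->
  nonneg_root y t -> ~ nonneg_root (s ** y) t ->
  exists c, (0 < c)%R /\ forall f, act (inv y) f t = (c * f s)%R.
Proof.
  intros Hs Ht Hy Hsy.
  set (c := act (inv y) (delta s) t).
  assert (Hc : forall f, act (inv y) f t = (c * f s)%R).
  { intro f.
    (* Subtracting f(s) [delta s] kills the value at [s]; each other coordinate of the root is at
       once nonnegative and nonpositive. *)
    assert (E : act (inv y) (fun x => 1 * f x + (- f s) * delta s x)%R t = 0%R).
    { destruct (root_expansion y Ht) as [D [_ ->]]. apply lsum_zero. intros x _.
      destruct (classic (x = s)) as [->|Hx]; [rewrite delta_same; ring|].
      assert (H1 := coords_nonneg_root x Hy).
      assert (H2 : (act (inv (s ** y)) (delta x) t <= 0)%R).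
      { apply nonpos_root; [exact Ht|exact Hsy|]. intros. apply delta_nonneg. }
      rewrite ginvM, (gens_inv Hs), act_mul, (act_gen _ Hs), dsig_fix in H2
        by (apply delta_diff; congruence).
      replace (act (inv y) (delta x) t) with 0%R by lra. ring. }
    rewrite act_linear in E. fold c in E. lra. }
  exists c. split; [|exact Hc].
  apply (nonneg_root_ones Ht) in Hy. rewrite Hc in Hy. unfold ones in Hy. lra.
Qed.

(* Among the [w] all of whose inversions are negative on [f], one maximising
   [cancel] makes [f] dominant. *)
Lemma orbit_sum_dominant (X : list W) : X <> [] ->
  exists w, forall s, Sg s -> (0 <= act w (orbit_sum X) s)%R.
Proof.
  intro HX. set (f := orbit_sum X).
  set (I := fun w => forall x s, Sg s -> nonneg_root x s -> ~ nonneg_root (w ** x) s ->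
    (act (inv x) f s < 0)%R).
  destruct (@exists_maximizer W I (cancel X) (list_sum (map (fun x => 2 * len x)%nat X)))
    as [w [Iw Hmax]].
  { exists e. intros x s _ H H'. rewrite gmul1 in H'. contradiction. }
  { intros. apply cancel_bound. }
  exists w. intros s Hs. destruct (Rlt_le_dec (act w f s) 0) as [Hneg|]; [exfalso|assumption].
  (* Otherwise the negative of w^(-1)(alpha_s) is an inversion of [w], on which [f] would be both
     positive by [Hneg] and negative by [Iw]. *)
  assert (Hw : nonneg_root (inv w) s).
  { apply NNPP. intro Hn. destruct (@root_sign (inv w) s Hs) as [|H]; [contradiction|].
    apply (Iw (inv w ** s) s Hs) in H.
    - rewrite nonneg_root_gen_mul, ginvK in H by exact Hs. lra.
    - rewrite gmulKV. intro H'. apply (@nonneg_root_mul e s Hs).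
      + now rewrite gmul1.
      + intros g Hg. rewrite ginv1, act_one. auto. }
  assert (Hl : (len w < len (s ** w))%nat).
  { apply (len_of_nonneg_root Hs) in Hw.
    now rewrite len_inv, <- (len_inv (inv w ** s)), ginvM, ginvK, (gens_inv Hs) in Hw. }
  (* A new inversion of [s ** w] is a positive multiple of w^(-1)(alpha_s), where [f] is negative by
     [Hneg]. *)
  assert (Isw : I (s ** w)).
  { intros x t Ht Hx Hswx. destruct (classic (nonneg_root (w ** x) t)) as [H|H].
    - rewrite <- gmulA in Hswx.
      destruct (root_flipped_by_gen Hs Ht H Hswx) as [c [Hc E]].
      assert (E' := E (act w f)). rewrite ginvM, act_mul, act_invK in E'.
      rewrite E'. nra.
    - now apply Iw. }
  specialize (Hmax _ Isw).
  enough (cancel X w < cancel X (s ** w))%nat by lia.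
  apply cancel_step; [exact Hs|exact Hl|].
  apply orbit_sum_exists_neg; [exact Hs|exact HX|fold f; lra].
Qed.

Lemma left_descent_gen (J : W -> Prop) (u : W) : (forall s, J s -> Sg s) ->
  gen J u -> u <> e -> exists s u', J s /\ gen J u' /\ u = s ** u' /\ (len u' < len u)%nat.
Proof.
  intros HJ Hu Hne. destruct (left_descent Hne) as [s [Hs Hl]].
  assert (Js : J s).
  { apply (@gen_descent J (inv u)); [exact HJ|now apply gen_inv|exact Hs|].
    now rewrite len_inv, <- (len_inv (inv u ** s)), ginvM, ginvK, (gens_inv Hs). }
  exists s, (s ** u). repeat split; [exact Js| | |exact Hl].
  - apply gen_mul; [now apply gen_incl|exact Hu].
  - symmetry. now apply gens_Kmul.
Qed.

Lemma bounded_length_finite (J : W -> Prop) (N : nat) : (forall s, J s -> Sg s) ->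
  is_finite J -> (forall u, gen J u -> (len u <= N)%nat) -> is_finite (gen J).
Proof.
  intros HJ [K HK] HN.
  assert (H : forall n, is_finite (fun u => gen J u /\ (len u <= n)%nat)).
  { induction n as [|n [l Hl]].
    - exists [e]. intros u [_ Hu]. left. symmetry. apply len_eq0. lia.
    - exists (e :: flat_map (fun s => map (gmul W s) l) K). intros u [Hu Hn].
      destruct (classic (u = e)) as [->|Hne]; [now left|right].
      destruct (left_descent_gen HJ Hu Hne) as [s [u' [Hs [Hu' [-> Hlt]]]]].
      apply in_flat_map. exists s. split; [auto|]. apply in_map, Hl. split; [exact Hu'|lia]. }
  destruct (H N) as [l Hl]. exists l. intros u Hu. apply Hl. split; auto.
Qed.

(** The group fixes the form, which vanishes on [J]; so each letter that lengthens an element also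
    raises [cancel], and its uniform bound limits the length. [J] itself is finite: every member is
    a left descent of some [x] in [X], hence occurs in the reduced word of [x]. *)
Lemma zero_stabiliser_finite (X : list W) : X <> [] ->
  is_finite (gen (fun s => Sg s /\ orbit_sum X s = 0%R)).
Proof.
  intro HX. set (J := fun s => Sg s /\ orbit_sum X s = 0%R).
  assert (HJ : forall s, J s -> Sg s) by now intros s [].
  assert (Hneg : forall u s, J s -> gen J u -> exists x, In x X /\ (act (u ** x) ones s < 0)%R).
  { intros u s [Hs E] Hu. apply orbit_sum_exists_neg; [exact Hs|exact HX|].
    rewrite (gen_fix HJ); [lra|now intros t []|exact Hu]. }
  apply (@bounded_length_finite J (list_sum (map (fun x => 2 * len x)%nat X)) HJ).
  - exists (flat_map rword X). intros s Js. destruct (Hneg e s Js (gen_one (A := J))) as [x [Hx Hn]].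
    rewrite gmul1 in Hn. apply in_flat_map. exists x. split; [exact Hx|].
    destruct (rword_spec x) as [Hov E].
    apply (@gen_descent (fun t => In t (rword x)) (inv x)).
    + exact Hov.
    + apply gen_inv. assert (H := @prod_gen (fun t => In t (rword x)) _ (fun t Ht => Ht)).
      now rewrite E in H.
    + now apply HJ.
    + apply len_of_negative; [now apply HJ|]. now rewrite ginvK.
  - intros u Hu. apply Nat.le_trans with (cancel X u); [|apply cancel_bound].
    remember (len u) as n eqn:En. revert u En Hu.
    induction n as [n IH] using lt_wf_ind. intros u -> Hu.
    destruct (classic (u = e)) as [->|Hne]; [rewrite len_one; lia|].
    destruct (left_descent_gen HJ Hu Hne) as [s [u' [Js [Hu' [-> Hlt]]]]].
    assert (H := IH _ Hlt u' eq_refl Hu').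
    assert (H' := cancel_step (HJ s Js) Hlt (Hneg u' s Js Hu')).
    pose proof (len_mul s u'). pose proof (len_gen (HJ s Js)). lia.
Qed.

Lemma finite_subgroup_in_parabolic (H : W -> Prop) : subgroup W H -> is_finite H ->
  exists P, parabolic P /\ is_finite P /\ forall x, H x -> P x.
Proof.
  intros HH [l Hl].
  destruct (list_NoDup (filter (fun x => decide (H x)) l))
    as [F [HF HFl]].
  assert (HFH : forall x, In x F <-> H x).
  { intro x. rewrite HFl, filter_In. pose proof (decide_true (H x)). firstorder. }
  assert (Hne : F <> []) by (intros ->; apply (proj2 (HFH e)), HH).
  destruct (orbit_sum_dominant Hne) as [w Hw].
  (* The translate by [w] of the invariant form is the orbit sum of [X]; it is dominant and fixed by
     the conjugate of [H] under [w]. *)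
  set (X := map (fun x => w ** x) F).
  assert (HX : X <> []) by (destruct F; [congruence|discriminate]).
  set (J := fun s => Sg s /\ orbit_sum X s = 0%R).
  destruct (zero_stabiliser_finite HX) as [L HL].
  exists (fun x => gen J (w ** x ** inv w)). repeat split.
  - exists (inv w), J. split; [now intros s []|]. intro x. now rewrite ginvK.
  - exists (map (fun y => inv w ** y ** w) L). intros x Hx. apply in_map_iff.
    exists (w ** x ** inv w). split; [group|now apply HL].
  - intros h Hh. apply stabiliser_gen; [auto| |apply cox|].
    + intros s Hs. unfold X. rewrite <- act_orbit_sum. now apply Hw.
    + unfold X. rewrite <- act_orbit_sum, !act_mul, act_invK.
      now rewrite (orbit_sum_invariant HH HF HFH Hh).
Qed.

(** * Parabolic hulls and maximal locally finite subgroups *)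

Definition hull (A : W -> Prop) (x : W) : Prop :=
  forall Q, parabolic Q -> (forall y, A y -> Q y) -> Q x.

(** Take a finite parabolic containing [A] with the shortest enclosing list. If another parabolic
    containing [A] missed one of its elements, intersecting the two would allow that entry to be
    dropped. *)
Lemma hull_finite_parabolic (A P : W -> Prop) :
  parabolic P -> is_finite P -> (forall y, A y -> P y) ->
  exists Q, parabolic Q /\ is_finite Q /\ forall x, Q x <-> hull A x.
Proof.
  intros HP [l Hl] HA.
  destruct (@exists_minimizer ((W -> Prop) * list W)
    (fun p => parabolic (fst p) /\ (forall y, A y -> fst p y) /\ forall x, fst p x -> In x (snd p))
    (fun p => length (snd p))) as [[Q L] [[HQ [HAQ HL]] Hmin]].
  { now exists (P, l). }
  simpl in *. exists Q. repeat split; [exact HQ|now exists L| |].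
  - intros Qx Q' HQ' HAQ'. apply NNPP. intro Hn.
    destruct (in_split _ _ (HL x Qx)) as [L1 [L2 ->]].
    specialize (Hmin (fun y => Q y /\ Q' y, L1 ++ L2)). simpl in Hmin.
    rewrite !length_app in Hmin. simpl in Hmin.
    enough (length L1 + Datatypes.S (length L2) <= length L1 + length L2)%nat by lia.
    apply Hmin. repeat split; [now apply parabolic_inter|auto|auto|].
    intros y [Qy Q'y]. apply HL in Qy. apply in_app_or in Qy. apply in_or_app.
    destruct Qy as [|[->|]]; tauto.
  - intro Hx. now apply Hx.
Qed.

Lemma locally_finite_hull (M : W -> Prop) (L : list W) : locally_finite W M ->
  (forall x, In x L -> M x) ->
  exists Q, parabolic Q /\ is_finite Q /\ forall x, Q x <-> hull (fun y => In y L) x.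
Proof.
  intros [_ HM] HL.
  destruct (@finite_subgroup_in_parabolic (gen (fun y => In y L))) as [P [HP [Pfin HLP]]].
  { apply gen_subgroup. }
  { destruct (HM L HL) as [l Hl]. now exists l. }
  apply (@hull_finite_parabolic _ P HP Pfin). intros y Hy. now apply HLP, gen_incl.
Qed.

(** Hulls of lists in [M] are directed under concatenation of lists, so any finite set of elements
    of their union lies in a single finite hull. *)
Lemma maximal_hull (M : W -> Prop) (L : list W) (x : W) : maximal_locally_finite W M ->
  (forall y, In y L -> M y) -> hull (fun y => In y L) x -> M x.
Proof.
  intros [HM Hmax] HL Hx.
  set (U := fun x => exists L, (forall y, In y L -> M y) /\ hull (fun y => In y L) x).
  apply (Hmax U); [| |now exists L].
  2:{ intros y Hy. exists [y]. split; [intros z [<-|[]]; exact Hy|].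
      intros Q _ HQ. apply HQ. now left. }
  assert (Hsub : subgroup W U).
  { repeat split.
    - exists []. split; [intros y []|]. intros Q HQ _. now apply parabolic_subgroup.
    - intros y z [L1 [HL1 Hy]] [L2 [HL2 Hz]]. exists (L1 ++ L2). split.
      + intros t Ht. apply in_app_or in Ht. destruct Ht; auto.
      + intros Q HQ HLQ. apply (parabolic_subgroup HQ);
          [apply Hy|apply Hz]; auto; intros t Ht; apply HLQ, in_or_app; auto.
    - intros y [L1 [HL1 Hy]]. exists L1. split; [exact HL1|].
      intros Q HQ HLQ. apply (parabolic_subgroup HQ), Hy; auto. }
  split; [exact Hsub|].
  intros X HX.
  assert (HXL : exists L, (forall y, In y L -> M y) /\ forall z, In z X -> hull (fun y => In y L) z).
  { induction X as [|z X IH].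
    - exists []. split; intros y [].
    - destruct IH as [L1 [HL1 H1]]; [intros; apply HX; now right|].
      destruct (HX z) as [L2 [HL2 H2]]; [now left|].
      exists (L1 ++ L2). split.
      + intros t Ht. apply in_app_or in Ht. destruct Ht; auto.
      + intros t [<-|Ht] Q HQ HLQ; [apply H2|apply (H1 t Ht)];
          auto; intros r Hr; apply HLQ, in_or_app; auto. }
  destruct HXL as [L' [HL' H']].
  destruct (locally_finite_hull HM HL') as [Q [HQ [[l Hl] HQh]]].
  exists l. intros y Hy. apply Hl, Hy; [now apply parabolic_subgroup|].
  intros z Hz. now apply HQh, H'.
Qed.

Lemma maximal_parabolic_cover (M : W -> Prop) (L : list W) : maximal_locally_finite W M ->
  (forall x, In x L -> M x) ->
  exists P, parabolic P /\ (forall x, In x L -> P x) /\ forall x, P x -> M x.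
Proof.
  intros HM HL. destruct (locally_finite_hull (proj1 HM) HL) as [P [HP [_ HPh]]].
  exists P. repeat split; [exact HP| |].
  - intros x Hx. apply HPh. intros Q _ HQ. now apply HQ.
  - intros x Hx. apply (maximal_hull HM HL). now apply HPh.
Qed.

(** Each element of [M] lies in some w W_J w^(-1) inside [M], and that subgroup is generated by the
    reflections w s w^(-1) with [s] in [J]. *)
Lemma maximal_reflection_subgroup (M : W -> Prop) :
  maximal_locally_finite W M -> reflection_subgroup W Sg M.
Proof.
  intro HM. set (A := fun t => is_reflection W Sg t /\ M t).
  exists A. split; [now intros t []|]. intro x. split.
  - intro Hx. destruct (@maximal_parabolic_cover M [x] HM) as [P [[w [J [HJ HP]]] [Hin HPM]]].
    { now intros y [<-|[]]. }
    assert (Px : P x) by (apply Hin; now left). apply HP in Px.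
    assert (H := Px (fun y => gen A (inv (inv w) ** y ** inv w))).
    replace x with (inv (inv w) ** (inv w ** x ** w) ** inv w) by group.
    apply H; [apply subgroup_conj, gen_subgroup|].
    intros s Hs. rewrite ginvK. apply gen_incl. split.
    + exists w, s. split; [auto|reflexivity].
    + apply HPM, HP. replace (inv w ** (w ** s ** inv w) ** w) with s by group.
      now apply gen_incl.
  - intro Hx. apply Hx; [apply HM|]. now intros y [].
Qed.

(** * Canonical generators *)

Lemma root_refl_iff (gamma : W -> R) (t : W) : root_refl W Sg gamma t <->
  exists w s, Sg s /\ (forall x, gamma x = act (inv w) (delta x) s) /\ t = w ** s ** inv w.
Proof.
  split.
  - intros [ws [s [Hws [Hs [Hg Ht]]]]]. exists (prod ws), s. repeat split; [exact Hs| |exact Ht].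
    intro x. now rewrite Hg, fsum_pairing, pairing_root.
  - intros [w [s [Hs [Hg ->]]]]. destruct (rword_spec w) as [Hw Ew].
    exists (rword w), s. rewrite Ew. repeat split; try assumption.
    intro x. now rewrite Hg, fsum_pairing, pairing_root, Ew.
Qed.

(* Invariance of the bilinear form: B(y(alpha_s), alpha_t) computed on either side. *)
Lemma act_Bst (y s t : W) : Sg s ->
  act y (Bst W s) t = act (inv y) (fun x => Bst W x t) s.
Proof.
  intro Hs. destruct (rword_spec y) as [Hov <-]. revert t.
  induction (rword y) as [|r l IH]; intro t.
  - simpl. now rewrite ginv1, !act_one.
  - apply over_cons in Hov. destruct Hov as [Hr Hl]. specialize (IH Hl). simpl.
    rewrite ginvM, (gens_inv Hr), !act_mul, !(act_gen _ Hr).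
    unfold dsig at 1. rewrite !IH.
    replace (dsig r (fun x => Bst W x t))
      with (fun x => 1 * Bst W x t + (- 2 * Bst W r t) * Bst W r x)%R
      by (extensionality x; unfold dsig; ring).
    rewrite (act_linear _ 1 (- 2 * Bst W r t) (fun x => Bst W x t) (Bst W r)).
    rewrite (@gen_agree Sg (inv (prod l)) (fun x => Bst W x r) (Bst W r)).
    + ring.
    + auto.
    + intros u Hu. now apply Bst_sym.
    + apply cox.
    + exact Hs.
Qed.

Lemma act_reflection (y s u : W) (f : W -> R) : Sg s ->
  act (y ** s ** inv y) f u =
  (f u - 2 * act (inv y) f s * act (inv y) (fun x => Bst W x u) s)%R.
Proof.
  intro Hs. rewrite !act_mul, (act_gen _ Hs), <- (act_Bst y u Hs).
  set (g := act (inv y) f).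
  replace (dsig s g) with (fun t => 1 * g t + (- 2 * g s) * Bst W s t)%R
    by (extensionality t; unfold dsig; ring).
  rewrite (act_linear y 1 (- 2 * g s) g (Bst W s)). unfold g at 1.
  rewrite <- act_mul, gmulVr, act_one. ring.
Qed.

(** Makes s_gamma well defined: by [act_reflection] the action of the reflection depends on the root
    only, and the action is faithful. *)
Lemma root_refl_unique (gamma gamma' : W -> R) (t t' : W) :
  root_refl W Sg gamma t -> root_refl W Sg gamma' t' -> (forall x, gamma x = gamma' x) -> t = t'.
Proof.
  intros H H' E. apply root_refl_iff in H, H'.
  destruct H as [y [s [Hs [Hg ->]]]], H' as [y' [s' [Hs' [Hg' ->]]]].
  assert (Ext := root_ext Hs Hs' (fun x => eq_trans (eq_sym (Hg x)) (eq_trans (E x) (Hg' x)))).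
  set (r := y ** s ** inv y). set (r' := y' ** s' ** inv y').
  assert (Er : forall f, act r f = act r' f).
  { intro f. extensionality u. unfold r, r'. now rewrite !act_reflection, !Ext. }
  assert (H : inv r' ** r = e).
  { apply act_faithful. intro f. now rewrite act_mul, Er, act_invK. }
  apply (f_equal (gmul W r')) in H. now rewrite gmulKV, gmulr1 in H.
Qed.

(** Replacing [w] by the shortest element of w W_J leaves the conjugate unchanged and makes every
    w(alpha_s) positive. *)
Lemma minimal_coset_representative (P : W -> Prop) : parabolic P ->
  exists w J, (forall s, J s -> Sg s) /\ (forall x, P x <-> gen J (inv w ** x ** w)) /\
    forall s, J s -> nonneg_root w s.
Proof.
  intros [w [J [HJ HP]]].
  destruct (@exists_minimizer W (gen J) (fun u => len (w ** u))) as [u [Hu Hmin]].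
  { exists e. apply gen_one. }
  exists (w ** u), J. split; [exact HJ|]. split.
  - intro x. rewrite HP.
    replace (inv (w ** u) ** x ** (w ** u)) with (inv u ** (inv w ** x ** w) ** u) by group.
    split; intro H.
    + apply gen_mul; [|exact Hu]. apply gen_mul; [now apply gen_inv|exact H].
    + replace (inv w ** x ** w) with (u ** (inv u ** (inv w ** x ** w) ** u) ** inv u) by group.
      apply gen_mul; [|now apply gen_inv]. now apply gen_mul.
  - intros s Hs. apply nonneg_root_of_len; [auto|]. rewrite <- gmulA.
    apply Hmin, gen_mul; [exact Hu|now apply gen_incl].
Qed.

(* A reflection in [W_J] fixes [off J], so [off J] vanishes on its root. *)
Lemma parabolic_root_expansion (J : W -> Prop) (z s : W) :
  (forall s, J s -> Sg s) -> Sg s -> gen J (z ** s ** inv z) ->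
  exists D, over J D /\
    forall f, act (inv z) f s = lsum D (fun x => act (inv z) (delta x) s * f x)%R.
Proof.
  intros HJ Hs Hr.
  apply (gen_stabiliser_off _ HJ) in Hr.
  assert (H0 : act (inv z) (off J) s = 0%R).
  { rewrite !act_mul in Hr. apply (f_equal (act (inv z))) in Hr. rewrite act_invK in Hr.
    apply (f_equal (fun g => g s)) in Hr. rewrite act_gen_at in Hr by exact Hs. lra. }
  destruct (root_expansion z Hs) as [D [_ HE]].
  (* The coordinates of a root share one sign, so a vanishing sum forces every term to vanish. *)
  assert (Hc : forall x, In x D -> (act (inv z) (delta x) s * off J x = 0)%R).
  { rewrite HE in H0. destruct (classic (nonneg_root z s)) as [Hz|Hz].
    - apply lsum_nonneg_eq0; [|exact H0]. intros x _.
      apply Rmult_le_pos; [now apply coords_nonneg_root|apply off_nonneg].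
    - intros x Hx.
      assert (H : (-1 * (act (inv z) (delta x) s * off J x) = 0)%R); [|lra].
      revert x Hx. apply lsum_nonneg_eq0.
      + intros x _. assert (H1 := off_nonneg J x).
        assert (H2 : (act (inv z) (delta x) s <= 0)%R).
        { apply nonpos_root; [exact Hs|exact Hz|]. intros. apply delta_nonneg. }
        nra.
      + clear - H0. enough (H : forall (T : Type) (l : list T) g,
          lsum l (fun x => -1 * g x)%R = (-1 * lsum l g)%R) by (rewrite H, H0; ring).
        intros T l g. induction l as [|a l IH]; simpl; [ring|]. rewrite IH. ring. }
  exists (filter (fun x => decide (J x)) D). split.
  - intros x Hx. apply filter_In in Hx. now apply decide_true.
  - intro f. rewrite HE, lsum_filter; [reflexivity|].
    intros x Hx Hn. apply decide_false in Hn.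
    specialize (Hc x Hx). unfold off in Hc.
    destruct excluded_middle_informative; [contradiction|].
    rewrite Rmult_1_r in Hc. rewrite Hc. ring.
Qed.

(* Writing [gamma = w beta] with [beta] in the span of [J] exhibits [gamma] as
   a nonnegative combination of the positive roots [w(alpha_t)], [t] in [J];
   indecomposability forces [gamma] to be one of them. *)
Lemma canonical_root_in_parabolic (M : W -> Prop) (gamma : W -> R) (x w : W) (J : W -> Prop) :
  (forall s, J s -> Sg s) -> (forall s, J s -> nonneg_root w s) ->
  (forall s, J s -> M (w ** s ** inv w)) ->
  Pi_of W Sg M gamma -> root_refl W Sg gamma x -> gen J (inv w ** x ** w) ->
  J (inv w ** x ** w).
Proof.
  intros HJ Hw HM [[[_ Hpos] _] Hindec] Hx HxJ.
  assert (Hx' := Hx). apply root_refl_iff in Hx'. destruct Hx' as [y [s [Hs [Hg Ex]]]].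
  assert (Hy : nonneg_root y s).
  { apply nonneg_root_coords; [exact Hs|]. intro u. now rewrite <- Hg. }
  set (z := inv w ** y).
  assert (Hz : gen J (z ** s ** inv z)).
  { replace (z ** s ** inv z) with (inv w ** x ** w); [exact HxJ|].
    rewrite Ex. unfold z. group. }
  destruct (parabolic_root_expansion HJ Hs Hz) as [D [HD HE]].
  set (c := fun t => act (inv z) (delta t) s) in *.
  assert (Hyz : forall f, act (inv y) f s = lsum D (fun t => c t * act (inv w) f t)%R).
  { intro f. rewrite <- HE, <- act_mul. f_equal. f_equal. unfold z. group. }
  assert (Hc : forall t, (0 <= c t)%R).
  { destruct (classic (nonneg_root z s)) as [H|H].
    - intro t. now apply coords_nonneg_root.
    (* The absolute value makes the form nonnegative everywhere, as [nonpos_root] requires, without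
       changing it on [J], where positivity of the w(alpha_t) already gives the sign. *)
    - exfalso. assert (Hy1 := nonneg_root_ones Hs Hy). rewrite Hyz in Hy1.
      assert (H0 : (act (inv z) (fun t => Rabs (act (inv w) ones t)) s <= 0)%R).
      { apply nonpos_root; [exact Hs|exact H|]. intros. apply Rabs_pos. }
      rewrite HE in H0. rewrite (@lsum_ext _ D _ (fun t => c t * act (inv w) ones t)%R) in H0; [lra|].
      intros t Ht. rewrite Rabs_right; [reflexivity|]. apply Rle_ge, Hw; [now apply HD|].
      intros. unfold ones. lra. }
  set (root := fun t u => act (inv w) (delta u) t).
  assert (Hroot : forall t, J t -> root_refl W Sg (root t) (w ** t ** inv w)).
  { intros t Ht. apply root_refl_iff. exists w, t. auto. }
  destruct (classic (exists t, J t /\ forall u, root t u = gamma u)) as [[t [Ht Et]]|Hn].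
  - rewrite (root_refl_unique Hx (Hroot t Ht) (fun u => eq_sym (Et u))).
    now replace (inv w ** (w ** t ** inv w) ** w) with t by group.
  - exfalso. apply Hindec.
    (* Zero coefficients are filtered out, since a decomposition in [Pi_of] demands strictly
       positive ones. *)
    exists (map (fun t => (c t, root t)) (filter (fun t => decide (0 < c t)%R) D)). split.
    + intros p Hp. apply in_map_iff in Hp. destruct Hp as [t [<- Ht]]. simpl.
      apply filter_In in Ht. destruct Ht as [Ht Hct]. apply (proj1 (decide_true _)) in Hct.
      apply HD in Ht. repeat split; [exact Hct| | | |].
      * exists (w ** t ** inv w). now apply Hroot.
      * intro u. now apply coords_nonneg_root, Hw.
      * exists (w ** t ** inv w). split; [now apply Hroot|now apply HM].
      * intro E. apply Hn. now exists t.
    + intro u. rewrite Hg, Hyz.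
      rewrite <- (@lsum_filter _ (fun t => decide (0 < c t)%R)).
      * induction (filter _ D) as [|t l IH]; simpl; [reflexivity|]. now rewrite IH.
      * intros t _ Ht. apply decide_false in Ht. specialize (Hc t).
        replace (c t) with 0%R by lra. ring.
Qed.

Lemma maximal_locally_parabolic (M : W -> Prop) :
  maximal_locally_finite W M -> locally_parabolic W Sg M.
Proof.
  intro HM. split; [now apply maximal_reflection_subgroup|].
  intros L HL.
  (* Membership of [gamma] in [Pi_of] supplies some reflection of [gamma] in [M]; uniqueness
     identifies it with [x]. *)
  assert (HLM : forall x, In x L -> M x).
  { intros x Hx. destruct (HL x Hx) as [gamma [[[_ [t [Ht Mt]]] _] Hgx]].
    now rewrite (root_refl_unique Hgx Ht (fun _ => eq_refl)). }
  destruct (maximal_parabolic_cover HM HLM) as [P [HP [HLP HPM]]].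
  destruct (minimal_coset_representative HP) as [w [J [HJ [HPJ Hw]]]].
  exists (inv w). intros x Hx. rewrite ginvK. apply HJ.
  destruct (HL x Hx) as [gamma [HPi Hg]].
  apply (@canonical_root_in_parabolic M gamma); try assumption.
  - intros s Hs. apply HPM, HPJ.
    replace (inv w ** (w ** s ** inv w) ** w) with s by group. now apply gen_incl.
  - now apply HPJ, HLP.
Qed.

End Coxeter.

(** * Existence of maximal locally finite subgroups *)

Lemma list_in_chain (T : Type) (F : (T -> Prop) -> Prop) (H : T -> Prop) (L : list T) :
  classical_sets.total_on F classical_sets.subset ->
  (exists A, F A) ->
  (forall x, In x L -> (exists2 A, F A & A x) \/ H x) ->
  exists A, F A /\ forall x, In x L -> A x \/ H x.
Proof.
  intros Htot HF. induction L as [|a L IH]; intro HL.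
  - destruct HF as [A HA]. exists A. split; [exact HA|]. intros x [].
  - destruct IH as [A [HA HAL]]; [intros; apply HL; now right|].
    destruct (HL a) as [[B HB Ba]|Ha]; [now left| |].
    + destruct (Htot A B HA HB) as [HAB|HBA].
      * exists B. split; [exact HB|]. intros x [<-|Hx]; [now left|].
        destruct (HAL x Hx) as [Ax|]; [left; now apply HAB|now right].
      * exists A. split; [exact HA|]. intros x [<-|Hx]; [left; now apply HBA|auto].
    + exists A. split; [exact HA|]. intros x [<-|Hx]; auto.
Qed.

Lemma maximal_locally_finite_exists (W : Group) (H : W -> Prop) :
  locally_finite W H -> exists M, maximal_locally_finite W M /\ forall x, H x -> M x.
Proof.
  intro HH.
  (* Zorn's lemma is applied to unions of all chains, including the empty one; adjoining [H] makes
     the empty union give [H] itself. *)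
  set (P := fun A : W -> Prop => locally_finite W (fun x => A x \/ H x)).
  destruct (@classical_sets.Zorn_bigcup W P) as [A [HA Hmax]].
  - intros F HFP Htot. unfold P.
    destruct (classic (exists A, F A)) as [HF|HF].
    2:{ assert (E : (fun x => classical_sets.bigcup F (fun X => X) x \/ H x) = H).
        { extensionality x. apply propositional_extensionality. split; [|tauto].
          intros [[A FA _]|Hx]; [exfalso; apply HF; now exists A|exact Hx]. }
        now rewrite E. }
    assert (Hin : forall A x, F A -> A x \/ H x ->
      classical_sets.bigcup F (fun X => X) x \/ H x).
    { intros A x FA [Ax|Hx]; [left; now exists A|now right]. }
    split; [repeat split|].
    + right. apply HH.
    + intros x y Hx Hy.
      destruct (@list_in_chain W F H [x; y] Htot HF) as [A [FA HAL]].
      { now intros z [<-|[<-|[]]]. }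
      apply (Hin A _ FA), (HFP A FA); apply HAL; simpl; auto.
    + intros x Hx.
      destruct (@list_in_chain W F H [x] Htot HF) as [A [FA HAL]].
      { now intros z [<-|[]]. }
      apply (Hin A _ FA), (HFP A FA). apply HAL. now left.
    + intros L HL. destruct (list_in_chain Htot HF HL) as [A [FA HAL]].
      now apply (HFP A FA).
  - exists (fun x => A x \/ H x). split; [|tauto]. split; [exact HA|].
    intros K HK HAK x Kx. left. apply NNPP. intro Hn. apply (Hmax K).
    + split; [intros y Ay; apply HAK; now left|]. intro HKA. apply Hn, HKA, Kx.
    + unfold P. replace (fun y => K y \/ H y) with K; [exact HK|].
      extensionality y. apply propositional_extensionality.
      split; [tauto|]. intros [|Hy]; [assumption|]. apply HAK. now right.
Qed.

Theorem theorem5p6 (W : Group) (S : W -> Prop) :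
  coxeter_system W S -> well_orderable W S ->
  forall H : W -> Prop, locally_finite W H ->
    (exists M : W -> Prop, maximal_locally_finite W M /\ forall x, H x -> M x) /\
    (forall M : W -> Prop, maximal_locally_finite W M -> (forall x, H x -> M x) ->
       locally_parabolic W S M).
Proof.
  intros HW _ H HH. split; [now apply maximal_locally_finite_exists|].
  intros M HM _. now apply maximal_locally_parabolic.
Qed.
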